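(* Let $N\ge3$ and let $\Omega$ be either a cone in $\mathbb{R}^N$ (in particular $\Omega=\mathbb{R}^N$ or $\Omega=\mathbb{R}^N_+$) or an open domain in $\mathbb{R}^N$ with $0\notin\overline{\Omega}$. Assume $s\in(0,2)$, $\lambda,\mu>0$, $\kappa>0$, $\alpha>1$, $\beta>1$, $\alpha+\beta=2^*(s)$. Let $(\phi,\psi)$ be a positive ground state solution of $$-\Delta u-\lambda\frac{|u|^{2^*(s)-2}u}{|x|^s}=\kappa\alpha\frac{|u|^{\alpha-2}u|v|^\beta}{|x|^s},\qquad -\Delta v-\mu\frac{|v|^{2^*(s)-2}v}{|x|^s}=\kappa\beta\frac{|u|^{\alpha}|v|^{\beta-2}v}{|x|^s}\quad\text{in }\Omega,\quad (u,v)\in D_0^{1,2}(\Omega)\times D_0^{1,2}(\Omega).$$ Then $$\phi=C(t_0)U,\qquad \psi=t_0C(t_0)U,$$ where $U$ is the ground state solution of $$-\Delta u=\mu_s(\Omega)\frac{u^{2^*(s)-1}}{|x|^s}\ \text{in }\Omega,\qquad u=0\ \text{on }\partial\Omega,$$ $t_0>0$ satisfies $g(t_0)=\inf_{t\in(0,+\infty)}g(t)$, and $$C(t_0):=\big[S_{\alpha,\beta,\lambda,\mu}(\Omega)\big]^{\frac1{2^*(s)-2}}\big(\lambda+\mu t_0^{2^*(s)}+2^*(s)\kappa t_0^\beta\big)^{-\frac1{2^*(s)}}.$$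
   Context: $2^*(s):=\frac{2(N-s)}{N-2}$. A cone in $\mathbb{R}^N$ is an open domain $\Omega$ with Lipschitz boundary such that $tx\in\Omega$ for every $t>0$, $x\in\Omega$. $D_0^{1,2}(\Omega)$ is the completion of $C_c^\infty(\Omega)$ in the norm $(\int_\Omega|\nabla u|^2dx)^{1/2}$; $\mathcal{D}:=D_0^{1,2}(\Omega)\times D_0^{1,2}(\Omega)$. $$g(t):=\frac{1+t^2}{\big[\lambda+\mu t^{2^*(s)}+2^*(s)\kappa t^\beta\big]^{2/2^*(s)}}.$$ $\mu_s(\Omega):=\inf\{\int_\Omega|\nabla u|^2dx: u\in D_0^{1,2}(\Omega),\ \int_\Omega\frac{|u|^{2^*(s)}}{|x|^s}dx=1\}$; a ground state solution $U$ of the scalar problem is a least energy nontrivial solution, equivalently a nonnegative minimizer of $\mu_s(\Omega)$ normalized by $\int_\Omega U^{2^*(s)}|x|^{-s}dx=1$. $$S_{\alpha,\beta,\lambda,\mu}(\Omega):=\inf_{(u,v)\in\mathcal{D}\setminus\{(0,0)\}}\frac{\int_\Omega(|\nabla u|^2+|\nabla v|^2)dx}{\Big(\int_\Omega\big(\lambda\frac{|u|^{2^*(s)}}{|x|^s}+\mu\frac{|v|^{2^*(s)}}{|x|^s}+2^*(s)\kappa\frac{|u|^\alpha|v|^\beta}{|x|^s}\big)dx\Big)^{2/2^*(s)}}.$$ Solutions of the system are critical points of $\Phi(u,v)=\frac12\int_\Omega(|\nabla u|^2+|\nabla v|^2)dx-\frac1{2^*(s)}\int_\Omega|x|^{-s}[\lambda|u|^{2^*(s)}+\mu|v|^{2^*(s)}+2^*(s)\kappa|u|^\alpha|v|^\beta]dx$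 on $\mathcal{D}$; a ground state solution is a solution $(u,v)\neq(0,0)$ with $\Phi(u,v)=\inf_{\mathcal{N}}\Phi$, $\mathcal{N}=\{(u,v)\in\mathcal{D}\setminus\{(0,0)\}:\langle\Phi'(u,v),(u,v)\rangle=0\}$; positive means both components are $>0$ in $\Omega$. *)

(* Defs.v *)
From HB Require Import structures.
From mathcomp Require Import all_boot all_order all_algebra.
From mathcomp Require Import all_classical all_reals all_analysis.

Set Implicit Arguments.
Unset Strict Implicit.
Unset Printing Implicit Defensive.

Import Order.TTheory GRing.Theory Num.Theory.
Import numFieldNormedType.Exports.

Local Open Scope classical_set_scope.
Local Open Scope ring_scope.

(* ['rV[R]_n] carries the sigma-algebra generated by the coordinates, which is
   the Borel one. *)

Definition measure_rV_display : measure_display.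
Proof. exact. Qed.

Section measurable_rV.
Context {R : realType} (n : nat).

Definition rV_coord (i : 'I_n) (x : 'rV[R]_n) : measurableTypeR R := x ord0 i.

Let rV_set0 : g_sigma_preimage rV_coord set0.
Proof. exact: sigma_algebra0. Qed.

Let rV_setC A : g_sigma_preimage rV_coord A -> g_sigma_preimage rV_coord (~` A).
Proof. exact: sigma_algebraC. Qed.

Let rV_bigcup (F : _^nat) : (forall i, g_sigma_preimage rV_coord (F i)) ->
  g_sigma_preimage rV_coord (\bigcup_i (F i)).
Proof. exact: sigma_algebra_bigcup. Qed.

HB.instance Definition _ := @isMeasurable.Build measure_rV_display
  ('rV[R]_n) (g_sigma_preimage rV_coord) rV_set0 rV_setC rV_bigcup.

End measurable_rV.

Section lebesgue_rV.
Context {R : realType}.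

Lemma measurable_rV_coord n (i : 'I_n) :
  measurable_fun [set: 'rV[R]_n] (@rV_coord R n i).
Proof.
move=> _ Y mY; rewrite setTI; apply: sub_sigma_algebra => /=.
rewrite -bigcup_seq/=; exists i => /=; first by rewrite mem_index_enum.
by exists Y => //; rewrite setTI.
Qed.

Lemma measurable_fun_rVP d (T : measurableType d) n (f : T -> 'rV[R]_n) :
  measurable_fun [set: T] f <->
  forall i, measurable_fun [set: T] (@rV_coord R n i \o f).
Proof.
apply: (@iff_trans _ (g_sigma_preimage
    (fun i => @rV_coord R n i \o f) `<=` measurable)).
  rewrite g_sigma_preimage_comp; split=> [mf A [/= C preC <-]|prefS].
    exact: mf.
  by move=> _ A mA; apply: prefS; exists A.
split=> [coordfS i|mf].
- move=> _ A mA.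
  apply: coordfS; apply: sub_sigma_algebra.
  case: n => [|n] in i f *; first by case: i.
  rewrite -bigcup_mkord_ord.
  exists i; first exact: ltn_ord.
  by exists A => //; rewrite inord_val.
- apply: smallest_sub; first exact: sigma_algebra_measurable.
  case: n => [|n] in f mf *; first by rewrite big_ord0.
  rewrite -bigcup_mkord_ord; apply: bigcup_sub => i Ii.
  by move=> A [B mB <-]; exact: mf.
Qed.

Definition rV_cons n (p : measurableTypeR R * 'rV[R]_n) : 'rV[R]_n.+1 :=
  \row_(i < n.+1) (if unlift ord0 i is Some j then p.2 ord0 j else p.1).

Definition rV_uncons n (x : 'rV[R]_n.+1) : measurableTypeR R * 'rV[R]_n :=
  (x ord0 ord0, \row_(j < n) x ord0 (lift ord0 j)).

Lemma rV_unconsK n : cancel (@rV_uncons n) (@rV_cons n).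
Proof.
move=> x; apply/rowP => i; rewrite mxE /=.
by case: unliftP => [j ->|->]; rewrite ?mxE.
Qed.

Lemma rV_consK n : cancel (@rV_cons n) (@rV_uncons n).
Proof.
move=> [a x]; rewrite /rV_uncons mxE unlift_none; congr pair.
by apply/rowP => j; rewrite !mxE liftK.
Qed.

Lemma measurable_rV_cons n : measurable_fun setT (@rV_cons n).
Proof.
apply/measurable_fun_rVP => i; case: (unliftP ord0 i) => [j ->|->].
- rewrite (_ : _ \o _ = @rV_coord R n j \o snd).
    by apply: measurableT_comp; [exact: measurable_rV_coord|].
  by apply/funext => p /=; rewrite /rV_coord mxE liftK.
- rewrite (_ : _ \o _ = fst); first exact: measurable_fst.
  by apply/funext => p /=; rewrite /rV_coord mxE unlift_none.
Qed.

Lemma measurable_rV_uncons n : measurable_fun setT (@rV_uncons n).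
Proof.
apply/measurable_fun_pairP; split; first exact: (measurable_rV_coord ord0).
apply/measurable_fun_rVP => j.
rewrite (_ : _ \o _ = @rV_coord R n.+1 (lift ord0 j)).
  exact: measurable_rV_coord.
by apply/funext => x; rewrite /rV_coord /= mxE.
Qed.

Section step.
Local Open Scope ereal_scope.
Variables (n : nat) (m : {sigma_finite_measure set 'rV[R]_n -> \bar R}).

Definition leb_step : set 'rV[R]_n.+1 -> \bar R :=
  pushforward (@lebesgue_measure R \x m) (@rV_cons n).

Let leb_step0 : leb_step set0 = 0.
Proof. by rewrite /leb_step /pushforward preimage_set0 measure0. Qed.

Let leb_step_ge0 A : 0 <= leb_step A.
Proof. by rewrite /leb_step /pushforward measure_ge0. Qed.

Let leb_step_sigma_additive : semi_sigma_additive leb_step.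
Proof.
move=> F mF tF mUF; rewrite /leb_step /pushforward preimage_bigcup.
apply: measure_semi_sigma_additive.
- by move=> k; rewrite -[X in measurable X]setTI; exact: measurable_rV_cons.
- apply/trivIsetP => /= i j _ _ ij; rewrite -preimage_setI.
  by move/trivIsetP : tF => /(_ _ _ _ _ ij) ->//; rewrite preimage_set0.
- rewrite -preimage_bigcup -[X in measurable X]setTI.
  exact: measurable_rV_cons.
Qed.

HB.instance Definition _ := isMeasure.Build _ _ _ leb_step
  leb_step0 leb_step_ge0 leb_step_sigma_additive.

Let leb_step_sigma_finite : sigma_finite setT leb_step.
Proof.
have [F UF Foo] : sigma_finite setT (@lebesgue_measure R \x m).
  have /sigma_finiteP[F [TF ndF Foo]] := sigma_finiteT (@lebesgue_measure R).
  have /sigma_finiteP[G [TG ndG Goo]] := sigma_finiteT m.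
  exists (fun k => F k `*` G k).
    rewrite -setXTT TF TG predeqE => -[x y]; split.
      move=> [/= [k _ Fkx] [l _ Gly]]; exists (maxn k l) => //; split.
      - by move: x Fkx; exact/subsetPset/ndF/leq_maxl.
      - by move: y Gly; exact/subsetPset/ndG/leq_maxr.
    by move=> [k _ []/= ? ?]; split; exists k.
  move=> k; have [? ?] := Foo k; have [? ?] := Goo k.
  split; first exact: measurableX.
  by rewrite product_measure1E// lte_mul_pinfty// ge0_fin_numE.
exists (fun k => @rV_uncons n @^-1` F k).
  by rewrite -preimage_bigcup -UF preimage_setT.
move=> k; have [mF Fk] := Foo k; split.
  by rewrite -[X in measurable X]setTI; exact: measurable_rV_uncons.
rewrite /leb_step /pushforward -comp_preimage.
rewrite (_ : _ \o _ = id) ?preimage_id//.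
by apply/funext => x /=; rewrite rV_consK.
Qed.

HB.instance Definition _ :=
  Measure_isSigmaFinite.Build _ _ _ leb_step leb_step_sigma_finite.

End step.

(* N-dimensional Lebesgue measure, as the N-fold product of the
   one-dimensional one. *)
Fixpoint leb (n : nat) : {sigma_finite_measure set 'rV[R]_n -> \bar R} :=
  match n with
  | 0 => \d_(0 : 'rV[R]_0)
  | n'.+1 => leb_step (leb n')
  end.

End lebesgue_rV.

Section euclidean.
Context {R : realType} {N : nat}.
Implicit Types (x y : 'rV[R]_N) (Omega : set 'rV[R]_N).

Definition dotv x y : R := \sum_(i < N) x ord0 i * y ord0 i.

(* The Euclidean norm; the library's [`|x|] on ['rV[R]_N] is the sup norm,
   which induces the same topology. *)
Definition enorm x : R := Num.sqrt (dotv x x).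

Definition domain Omega := [/\ open Omega, connected Omega & Omega !=set0].

(* Near each boundary point, [Omega] is the strict epigraph, in some unit
   direction [nu], of a Lipschitz function [gamma] defined on the hyperplane
   orthogonal to [nu] (only the values of [gamma] there are used). *)
Definition lipschitz_boundary Omega :=
  forall x0, (closure Omega `\` interior Omega) x0 ->
  exists (nu : 'rV[R]_N) (gamma : 'rV[R]_N -> R) (L r : R),
    [/\ enorm nu = 1,
        0 < r,
        forall y z, `|gamma y - gamma z| <= L * enorm (y - z)
      & forall x, enorm (x - x0) < r ->
          (Omega x <-> gamma (x - dotv x nu *: nu) < dotv x nu)].

Definition cone Omega :=
  [/\ domain Omega, lipschitz_boundary Omega
    & forall (t : R) x, 0 < t -> Omega x -> Omega (t *: x)].

Definition ebasis (i : 'I_N) : 'rV[R]_N := delta_mx ord0 i.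

Definition egrad (f : 'rV[R]_N -> R) x : 'rV[R]_N :=
  \row_(i < N) 'D_(ebasis i) f x.

Definition iter_partial (l : seq 'I_N) (f : 'rV[R]_N -> R) : 'rV[R]_N -> R :=
  foldr (fun i h x => 'D_(ebasis i) h x) f l.

Definition smooth (f : 'rV[R]_N -> R) := forall l : seq 'I_N,
  continuous (iter_partial l f) /\
  forall i x, derivable (iter_partial l f) x (ebasis i).

Definition support_of (f : 'rV[R]_N -> R) := closure [set x | f x != 0].

Definition Ccinfty Omega : set ('rV[R]_N -> R) :=
  [set f | [/\ smooth f, compact (support_of f) & support_of f `<=` Omega]].

End euclidean.

Section D012.
Context {R : realType} {N : nat}.
Implicit Types (Omega : set 'rV[R]_N).

(* A function together with its gradient. *)
Definition fgrad : Type := (('rV[R]_N -> R) * ('rV[R]_N -> 'rV[R]_N))%type.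

Definition critical_sobolev : R := 2 * N%:R / (N%:R - 2).

(* The completion of [Ccinfty Omega] in the norm |grad u|_{L^2(Omega)}: since
   N >= 3, the Sobolev inequality makes a sequence that is Cauchy in this norm
   also converge in L^{2N/(N-2)}(Omega), so that the completion is the closure
   of {(eta, grad eta)} in L^{2N/(N-2)}(Omega) x L^2(Omega)^N.  Elements are
   given by Borel representatives, only their values a.e. in Omega matter, and
   the gradient [u.2] is determined a.e. by the function [u.1]. *)
Definition D012 Omega : set fgrad := [set u : fgrad |
  [/\ measurable_fun Omega u.1,
      forall i, measurable_fun Omega (fun x => u.2 x ord0 i)
    & exists eta : nat -> 'rV[R]_N -> R,
      [/\ forall k, Ccinfty Omega (eta k),
          (\int[leb N]_(x in Omega)
            (`|eta k x - u.1 x| `^ critical_sobolev)%:E)%E @[k --> \oo] --> 0%E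
        & (\int[leb N]_(x in Omega)
            (enorm (egrad (eta k) x - u.2 x) ^+ 2)%:E)%E @[k --> \oo] --> 0%E]]].

Definition null_on Omega (u : fgrad) :=
  {ae leb N, forall x, Omega x -> u.1 x = 0}.

Definition positive_on Omega (u : fgrad) :=
  {ae leb N, forall x, Omega x -> 0 < u.1 x}.

Definition dirichlet Omega (u : fgrad) : R :=
  \int[leb N]_(x in Omega) (enorm (u.2 x) ^+ 2).

Definition D012_pair Omega : set (fgrad * fgrad) :=
  [set w : fgrad * fgrad |
  [/\ D012 Omega w.1, D012 Omega w.2
    & ~ (null_on Omega w.1 /\ null_on Omega w.2)]].

End D012.

Arguments fgrad : clear implicits.

Section hardy_sobolev.
Context {R : realType} {N : nat}.
Implicit Types (u v : fgrad R N).
Variables (Omega : set 'rV[R]_N) (s : R).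

(* The exponent 2^*(s). *)
Definition hsexp : R := 2 * (N%:R - s) / (N%:R - 2).

Let p := hsexp.

Definition hs_int u : R :=
  \int[leb N]_(x in Omega) (`|u.1 x| `^ p / enorm x `^ s).

Definition mu_s : R :=
  inf [set dirichlet Omega u | u in [set u | D012 Omega u /\ hs_int u = 1]].

(* Weak solutions of - Delta u = mu_s u^(p-1) / |x|^s in Omega, u = 0 on the
   boundary; [u >= 0] is needed for the power to make sense. *)
Definition scalar_solution u :=
  [/\ D012 Omega u,
      {ae leb N, forall x, Omega x -> 0 <= u.1 x}
    & forall h, D012 Omega h ->
      \int[leb N]_(x in Omega) dotv (u.2 x) (h.2 x) =
      mu_s * \int[leb N]_(x in Omega)
               (u.1 x `^ (p - 1) * h.1 x / enorm x `^ s)].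

Definition scalar_energy u : R :=
  1 / 2 * dirichlet Omega u - mu_s / p * hs_int u.

(* A least energy nontrivial solution, which amounts to being a nonnegative
   normalized minimizer for [mu_s]; both descriptions are recorded. *)
Definition scalar_ground_state u :=
  [/\ scalar_solution u, ~ null_on Omega u,
      forall w, scalar_solution w -> ~ null_on Omega w ->
        scalar_energy u <= scalar_energy w,
      hs_int u = 1
    & dirichlet Omega u = mu_s].

Variables (lambda mu kappa alpha beta : R).

Definition gfun (t : R) : R :=
  (1 + t ^+ 2) /
  (lambda + mu * t `^ p + p * kappa * t `^ beta) `^ (2 / p).

Definition system_int u v : R :=
  \int[leb N]_(x in Omega)
    (lambda * (`|u.1 x| `^ p / enorm x `^ s) +
     mu * (`|v.1 x| `^ p / enorm x `^ s) +
     p * kappa * (`|u.1 x| `^ alpha * `|v.1 x| `^ beta / enorm x `^ s)).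

Definition S_const : R :=
  inf [set (dirichlet Omega w.1 + dirichlet Omega w.2) /
           system_int w.1 w.2 `^ (2 / p) | w in D012_pair Omega].

Definition Phi u v : R :=
  1 / 2 * (dirichlet Omega u + dirichlet Omega v) - 1 / p * system_int u v.

(* <Phi'(u,v),(h,k)> = l, as a directional derivative (Phi is of class C^1). *)
Definition dPhi u v (h k : fgrad R N) (l : R) :=
  is_derive (0 : R) (1 : R) (fun t : R => Phi (u + t *: h) (v + t *: k)) l.

Definition nehari : set (fgrad R N * fgrad R N) :=
  [set w | D012_pair Omega w /\ dPhi w.1 w.2 w.1 w.2 0].

Definition system_solution u v :=
  [/\ D012 Omega u, D012 Omega v
    & forall h k, D012 Omega h -> D012 Omega k -> dPhi u v h k 0].

Definition system_ground_state u v :=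
  [/\ system_solution u v, ~ (null_on Omega u /\ null_on Omega v)
    & Phi u v = inf [set Phi w.1 w.2 | w in nehari]].

Definition Cconst (t : R) : R :=
  S_const `^ (1 / (p - 2)) *
  (lambda + mu * t `^ p + p * kappa * t `^ beta) `^ (- (1 / p)).

End hardy_sobolev.

Arguments hsexp {R} N s.
Arguments gfun {R} N s lambda mu kappa beta t.

(* Main.v *)
Require Import Defs.
From HB Require Import structures.
From mathcomp Require Import all_boot all_order all_algebra.
From mathcomp Require Import all_classical all_reals all_analysis.
From mathcomp Require Import measurable_realfun ring lra.

Set Implicit Arguments.
Unset Strict Implicit.
Unset Printing Implicit Defensive.

Import Order.TTheory GRing.Theory Num.Theory.
Import numFieldNormedType.Exports.

Local Open Scope classical_set_scope.
Local Open Scope ring_scope.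

(** For a pair [(u, v)] let [Q(u, v)] be the quotient whose infimum is the
    constant [S], with [B(u, v)] the integral in its denominator, and for a
    single function let [q(u)] be the quotient
    [|grad u|^2 / (int |u|^p / |x|^s)^(2/p)] whose infimum is [mu_s].

    Rescaling a pair onto the Nehari set ([nehari_rescale]) turns its energy
    into an increasing function of [Q], so a ground state [(phi, psi)]
    minimises [Q] ([ground_state_quotient_min]).  Along the diagonal one has
    [Q(u, t u) = g(t) q(u)] ([quotient_diag]).  Conversely, write
    [int phi^p / |x|^s = a^p], [int psi^p / |x|^s = b^p] and [t0 = b / a]:
    Hoelder's inequality gives [B(phi, psi) <= a^p denom(t0)], whence
    [g(t0) min(q(phi), q(psi)) <= Q(phi, psi) <= g(t) q(u)] for all [t > 0] and
    all [u].  Choosing [u] and [t] among [phi], [psi] and [t0] closes this chain.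
    All its inequalities are then equalities: [q(phi) = q(psi)] is the minimum
    of [q], [t0] minimises [g], and the equality case of Hoelder's inequality
    ([mixed_holder]) makes [psi] equal to [t0 phi].  The identity
    [|grad phi|^2 + |grad psi|^2 = B(phi, psi)] of the Nehari set then gives
    [a = C(t0)], and [U = phi / a] is a normalised minimiser of [q].

    That [U] solves the scalar equation needs no differentiation under the
    integral sign: by Hoelder and minimality, the quadratic form
    [|grad w|^2 - mu_s (int U^(p-1) w / |x|^s)^2] is nonnegative and vanishes at
    [w = U], so its polar form vanishes there as well ([scalar_ground_state_min]).

    The argument breaks down if some element of [D012] has an infinite
    Hardy-Sobolev integral, because the real-valued integral of such a function
    is [0] and the infima above collapse.  Finiteness ([hs_integrable]) follows
    from [|u|^p / |x|^s <= |u|^2 / |x|^2 + |u|^q], with [q] the critical Sobolev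
    exponent.  The second term is integrable by the definition of [D012]; the
    first is controlled by Hardy's inequality ([hardy]), proved for test
    functions by integrating by parts and extended by truncation and Fatou's
    lemma.  Hardy's inequality also shows that only null functions have zero
    Dirichlet integral. *)

(** * Lebesgue measure on row vectors *)

Lemma le_of_eq d (T : porderType d) (x y : T) : x = y -> (x <= y)%O.
Proof. by move=> ->. Qed.

Section lebesgue_rV_facts.
Context {R : realType}.

Lemma ler_norm_rV n (x : 'rV[R]_n) i : `|x ord0 i| <= `|x|.
Proof.
rewrite /Num.norm/= mx_normrE.
exact: (le_bigmax _ (fun ij => `|x ij.1 ij.2|) (ord0, i)).
Qed.

Lemma rV_norm_ler n (x : 'rV[R]_n) e : 0 <= e ->
  (forall i, `|x ord0 i| <= e) -> `|x| <= e.
Proof.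
move=> e0 xe; rewrite /Num.norm/= mx_normrE.
by apply: bigmax_le => // -[i j] _ /=; rewrite (ord1 i).
Qed.

Lemma rV_norm_ltr n (x : 'rV[R]_n) e : 0 < e ->
  (forall i, `|x ord0 i| < e) -> `|x| < e.
Proof.
move=> e0 xe; rewrite /Num.norm/= mx_normrE.
by apply: bigmax_lt => // -[i j] _ /=; rewrite (ord1 i).
Qed.

Let box n (c : 'rV[rat]_n * nat) : set 'rV[R]_n :=
  \bigcap_(i in [set: 'I_n])
    (@rV_coord R n i @^-1` ball (ratr (c.1 ord0 i) : R) c.2.+1%:R^-1).

Let measurable_box n (c : 'rV[rat]_n * nat) : measurable (box c).
Proof.
apply: fin_bigcap_measurable => // i _; rewrite -[X in measurable X]setTI.
by apply: measurable_rV_coord => //; exact: open_measurable (ball_open _ _).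
Qed.

(** The measurable structure is generated by the coordinates; boxes with rational
    centres and radii [1/k] form a countable base of the topology. *)
Lemma open_measurable_rV n (A : set 'rV[R]_n) : open A -> measurable A.
Proof.
move=> oA.
have -> : A = \bigcup_c (if `[< box c `<=` A >] then box c else set0).
  apply/seteqP; split => [x Ax|x [c _]]; last by case: asboolP => // cA; exact: cA.
  have [e /= e0 xeA] : exists2 e : R, 0 < e & ball x e `<=` A.
    by apply/nbhs_ballP; exact: open_nbhs_nbhs.
  have [k ke] : exists k, (k.+1%:R^-1 : R) < e / 2.
    have /ltr_add_invr[k] : (0 : R) < e / 2 by rewrite divr_gt0.
    by rewrite add0r => ?; exists k.
  have k0 : (0 : R) < k.+1%:R^-1 by rewrite invr_gt0.
  have [d dE] : exists d : R, d = k.+1%:R^-1 by exists (k.+1%:R^-1).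
  rewrite -dE in k0 ke.
  have /choice[q hq] (i : 'I_n) :
      exists q : rat, `|x ord0 i - ratr q| < d.
    have /rat_in_itvoo[q] : x ord0 i - d < x ord0 i + d by lra.
    rewrite in_itv/= => /andP[q1 q2]; exists q; rewrite ltr_norml; lra.
  exists (\row_i q i, k) => //; case: asboolP => [_ i _ | []].
    by rewrite /= /rV_coord -ball_normE /= mxE distrC -dE.
  move=> y by_; apply: xeA; rewrite -ball_normE/=.
  apply: (rV_norm_ltr e0) => i.
  have := by_ i I; rewrite /= /rV_coord -ball_normE /= mxE -dE => yq.
  rewrite !mxE (_ : _ - _ = (x ord0 i - ratr (q i)) + (ratr (q i) - y ord0 i));
    last by ring.
  rewrite (le_lt_trans (ler_normD _ _))//.
  by have := hq i; lra.
apply: countable_bigcupT_measurable => [|c]; first exact: countableP.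
by case: ifP => _ //; exact: measurable_box.
Qed.

Lemma continuous_measurable_rV n (f : 'rV[R]_n -> R) :
  continuous f -> measurable_fun setT f.
Proof.
move=> cf; apply: (measurability _ (RGenOpens.measurableE R)) => /= _ [_ [a [b ->]] <-].
rewrite setTI; apply: open_measurable_rV.
by move/continuousP : cf; apply; exact: interval_open.
Qed.

Lemma leb_cons n (A : set 'rV[R]_n.+1) : leb n.+1 A =
  (lebesgue_measure \x leb n)%E (@rV_cons R n @^-1` A).
Proof. by []. Qed.

Lemma measurable_norm_le n (M : R) : measurable [set x : 'rV[R]_n | `|x| <= M].
Proof.
have oM : open [set x : 'rV[R]_n | M < `|x|].
  have -> : [set x : 'rV[R]_n | M < `|x|] = Num.norm @^-1` `]M, +oo[.
    by apply/seteqP; split => x /=; rewrite in_itv/= andbT.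
  by apply: open_comp; [move=> x _; exact: norm_continuous|exact: interval_open].
have -> : [set x : 'rV[R]_n | `|x| <= M] = ~` [set x : 'rV[R]_n | M < `|x|].
  by apply/seteqP; split => x /=; rewrite leNgt => /negP.
by apply: measurableC; exact: open_measurable_rV.
Qed.

Lemma leb_bounded n (M : R) :
  (leb n [set x : 'rV[R]_n | (`|x| <= M)%R] < +oo)%E.
Proof.
elim: n => [|n IH].
  by rewrite /= diracE ltry.
rewrite leb_cons.
apply: (@le_lt_trans _ _
  ((lebesgue_measure \x leb n)%E (`[(- M)%R, M] `*` [set x : 'rV[R]_n | (`|x| <= M)%R]))).
  apply: le_measure; rewrite ?inE.
  - rewrite -[X in measurable X]setTI; apply: measurable_rV_cons => //.
    exact: measurable_norm_le.
  - by apply: measurableX => //; exact: measurable_norm_le.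
  move=> [a x] /= axM; split => /=.
    have := ler_norm_rV (rV_cons (a, x)) ord0.
    rewrite mxE unlift_none /= in_itv /= -ler_norml => /le_trans; exact.
  apply: rV_norm_ler => [|i]; first exact: le_trans axM.
  have := ler_norm_rV (rV_cons (a, x)) (lift ord0 i).
  by rewrite mxE liftK /= => /le_trans; exact.
rewrite product_measure1E//; last exact: measurable_norm_le.
rewrite lte_mul_pinfty//.
rewrite ge0_fin_numE//.
have := lebesgue_measure_itv (`[- M, M]%R : interval R) => /= ->.
by case: ifP; rewrite ltry.
Qed.

(** Weights such as [1 / |x|^s] take a junk value at the origin; this makes it
    harmless. *)
Lemma leb_point0 n : leb n.+1 [set (0 : 'rV[R]_n.+1)] = 0%E.
Proof.
have mn : measurable [set (0 : 'rV[R]_n)].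
  rewrite (_ : [set _] = [set x : 'rV[R]_n | `|x| <= 0]).
    exact: measurable_norm_le.
  by apply/seteqP; split => x /=; rewrite normr_le0 => /eqP.
rewrite leb_cons (_ : _ @^-1` _ = [set 0] `*` [set 0]).
  by rewrite product_measure1E// [X in (X * _)%E]lebesgue_measure_set1 mul0e.
apply/seteqP; split => [[a x]/= /rowP ax0|[a x] /= [-> ->]].
  split; first by have := ax0 ord0; rewrite !mxE unlift_none.
  by apply/rowP => i; have := ax0 (lift ord0 i); rewrite !mxE liftK.
by apply/rowP => i; rewrite !mxE; case: unliftP => [j|] _ /=; rewrite ?mxE.
Qed.

End lebesgue_rV_facts.

(** * Integration by parts *)

Section integration_by_parts.
Context {R : realType}.

Lemma bounded_supp_integrable n (f : 'rV[R]_n -> R) (M K : R) :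
  measurable_fun setT f -> (forall x, `|f x| <= K) ->
  (forall x, M < `|x| -> f x = 0) ->
  (leb n).-integrable setT (EFin \o f).
Proof.
move=> mf fK f0; set B := [set x : 'rV[R]_n | `|x| <= M].
have mB : measurable B by exact: measurable_norm_le.
have -> : EFin \o f = (EFin \o f) \_ B.
  apply/funext => x; rewrite patchE; case: ifPn => //=.
  by rewrite notin_setE /B /= => /negP; rewrite -ltNge => /f0 ->.
apply/(integrable_mkcond _ mB)/measurable_bounded_integrable => //.
- exact: leb_bounded.
- exact: measurable_funS mf.
by exists K; split => [|L KL x _ /=]; [exact: num_real|exact: le_trans (ltW KL)].
Qed.

Lemma continuous_supp_bounded n (f : 'rV[R]_n -> R) (M : R) :
  continuous f -> (forall x, M < `|x| -> f x = 0) ->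
  exists K, forall x, `|f x| <= K.
Proof.
move=> cf f0; set B := [set x : 'rV[R]_n | `|x| <= M].
have /compact_bounded [K [Kr KB]] : compact (f @` B).
  apply: continuous_compact; first exact: continuous_subspaceT.
  apply: bounded_closed_compact.
    by exists M; split=> [|K MK x /= /le_trans]; [exact: num_real|apply; exact: ltW].
  rewrite (_ : B = Num.norm @^-1` `]-oo, M]).
    by apply: closed_comp; [move=> x _; exact: norm_continuous|exact: interval_closed].
  by apply/seteqP; split => x /=; rewrite in_itv.
exists (`|K| + 1) => x; have KK : K < `|K| + 1 by have := ler_norm K; lra.
have [xM|/f0 ->] := leP `|x| M; first by apply: KB KK _ _; exists x.
by rewrite normr0 addr_ge0.
Qed.

Lemma continuous_supp_integrable n (f : 'rV[R]_n -> R) (M : R) :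
  continuous f -> (forall x, M < `|x| -> f x = 0) ->
  (leb n).-integrable setT (EFin \o f).
Proof.
move=> cf f0; have [K fK] := continuous_supp_bounded cf f0.
exact: bounded_supp_integrable (continuous_measurable_rV cf) fK f0.
Qed.

(** Fubini's theorem, for both orders of integration: the first coordinate can
    be integrated first or last. *)
Lemma integral_leb_cons n (f : 'rV[R]_n.+1 -> \bar R) :
  (leb n.+1).-integrable setT f ->
  ((\int[leb n.+1]_x f x = \int[leb n]_x \int[lebesgue_measure]_a f (rV_cons (a, x)))
  /\ (\int[leb n.+1]_x f x = \int[lebesgue_measure]_a \int[leb n]_x f (rV_cons (a, x))))%E.
Proof.
move=> fi.
have mf : measurable_fun setT f by case/integrableP : fi.
have mc : measurable_fun setT (@rV_cons R n) by exact: measurable_rV_cons.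
have gi : (lebesgue_measure \x leb n)%E.-integrable setT (f \o @rV_cons R n).
  apply/integrableP; split; first exact: measurableT_comp.
  case/integrableP : fi => _; rewrite /= /leb_step.
  by rewrite ge0_integral_pushforward//; exact: measurableT_comp.
have -> : (\int[leb n.+1]_x f x =
    \int[(lebesgue_measure \x leb n)%E]_z (f \o @rV_cons R n) z)%E.
  by rewrite [LHS]integral_pushforward.
by split; [rewrite -integral21_prod_meas1|rewrite -integral12_prod_meas1].
Qed.

Lemma derive_supp n (f : 'rV[R]_n -> R) (M : R) (v : 'rV[R]_n) :
  (forall x, M < `|x| -> f x = 0) -> forall x, M < `|x| -> 'D_v f x = 0.
Proof.
move=> f0 x Mx; rewrite (@near_eq_derive _ _ _ f (cst 0)) ?derive_cst//.
near=> y; apply: f0; near: y.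
by apply: (cvgr_gt `|x|) => //; exact: norm_continuous.
Unshelve. all: by end_near. Qed.

Lemma rV_cons0E n (a b : R) (x : 'rV[R]_n) :
  rV_cons (b + a, x) = b *: ebasis ord0 + rV_cons (a, x).
Proof.
apply/rowP => i; rewrite /ebasis !mxE /=; case: unliftP => [j ->|->].
  by rewrite mulr0 add0r.
by rewrite mulr1.
Qed.

Lemma rV_consSE n (a b : R) (i : 'I_n) (x : 'rV[R]_n) :
  rV_cons (a, b *: ebasis i + x) =
  b *: ebasis (lift ord0 i) + rV_cons (a, x).
Proof.
apply/rowP => k; rewrite /ebasis !mxE /=; case: unliftP => [j ->|->].
  by rewrite !mxE (inj_eq (@lift_inj _ _)).
by rewrite /= mulr0 add0r.
Qed.

Lemma integral_derive1_supp (g : R -> R) (M : R) :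
  (forall x, derivable g x 1) -> continuous ('D_1 g) ->
  (forall x, M < `|x| -> g x = 0) ->
  (\int[lebesgue_measure]_x ('D_1 g x)%:E = 0)%E.
Proof.
move=> dg cg g0; set K := `|M| + 1.
have MK : M < K by rewrite /K; have := ler_norm M; lra.
have K0 : 0 < K by rewrite /K; have := normr_ge0 M; lra.
have gc : continuous g by move=> x; exact/differentiable_continuous/derivable1_diffP.
have -> : (\int[lebesgue_measure]_x ('D_1 g x)%:E =
    \int[lebesgue_measure]_(x in `[(- K)%R, K]) ('D_1 g x)%:E)%E.
  rewrite [RHS]integral_mkcond; apply: eq_integral => x _.
  rewrite patchE; case: ifPn => //; rewrite notin_setE/= in_itv/= => /negP.
  rewrite -ler_norml -ltNge => Kx.
  rewrite (@near_eq_derive _ _ _ g (cst 0)) ?derive_cst//.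
  near=> y; apply: g0; near: y.
  by apply: (cvgr_gt `|x|) => //; [exact: norm_continuous|exact: lt_trans Kx].
rewrite (@continuous_FTC2 _ _ g); first last.
- by move=> x _; rewrite derive1E.
- by split => //; [apply: cvg_at_right_filter|apply: cvg_at_left_filter]; exact: gc.
- exact: continuous_subspaceT.
- lra.
by rewrite !g0 ?subee// ?normrN gtr0_norm.
Unshelve. all: by end_near. Qed.

(** For the first coordinate this is the fundamental theorem of calculus on each
    line; the other coordinates are those of a slice, where the statement holds
    by induction on the dimension. *)
Lemma integral_partial0 n (i : 'I_n) (f : 'rV[R]_n -> R) (M : R) :
  continuous f -> (forall x, derivable f x (ebasis i)) ->
  continuous ('D_(ebasis i) f) -> (forall x, M < `|x| -> f x = 0) ->
  (\int[leb n]_x ('D_(ebasis i) f x)%:E = 0)%E.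
Proof.
elim: n i f => [[]//|n IH] i f cf df cdf f0.
have [I1 I2] := integral_leb_cons
  (continuous_supp_integrable cdf (derive_supp (ebasis i) f0)).
have cons_cont0 (x : 'rV[R]_n) : continuous (fun a : R => rV_cons (a, x)).
  move=> a; apply/cvgrPdist_lt => e e0; apply/nbhs_ballP; exists e => // b.
  move=> /= abe; apply: rV_norm_ltr => // j.
  by rewrite !mxE; case: unliftP => //= k _; rewrite subrr normr0.
have cons_contS (a : R) : continuous (fun x : 'rV[R]_n => rV_cons (a, x)).
  move=> x; apply/(@cvgrPdist_lt _ _ _ (nbhs x)) => e e0.
  apply/nbhs_ballP; exists e => // y.
  rewrite -ball_normE /= => xye; apply: rV_norm_ltr => // j.
  rewrite !mxE; case: unliftP => [k _|_] /=; last by rewrite subrr normr0.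
  by apply: le_lt_trans xye; have := ler_norm_rV (x - y) k; rewrite !mxE.
have consM0 (x : 'rV[R]_n) a : M < `|a| -> M < `|rV_cons (a, x)|.
  move/lt_le_trans; apply.
  by have := ler_norm_rV (rV_cons (a, x)) ord0; rewrite mxE unlift_none.
have consMS (x : 'rV[R]_n) a : M < `|x| -> M < `|rV_cons (a, x)|.
  move/lt_le_trans; apply; apply: rV_norm_ler => // k.
  by have := ler_norm_rV (rV_cons (a, x)) (lift ord0 k); rewrite mxE liftK.
case: (unliftP ord0 i) I1 I2 df cdf => [j ->|->] I1 I2 df cdf.
- rewrite I2; apply: integral0_eq => a _.
  have E x b : f (rV_cons (a, b *: ebasis j + x)) =
      f (b *: ebasis (lift ord0 j) + rV_cons (a, x)) by rewrite rV_consSE.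
  have DE x : 'D_(ebasis j) (fun y => f (rV_cons (a, y))) x =
      'D_(ebasis (lift ord0 j)) f (rV_cons (a, x)).
    by rewrite /derive; under eq_fun do rewrite /= E.
  transitivity (\int[leb n]_x ('D_(ebasis j) (fun y => f (rV_cons (a, y))) x)%:E)%E.
    by apply: eq_integral => x _; rewrite /= DE.
  apply: IH.
  + by move=> x; apply: continuous_comp; [exact: cons_contS|exact: cf].
  + move=> x; have := df (rV_cons (a, x)); rewrite /derivable.
    by under [in X in _ -> X]eq_fun do rewrite /= E.
  + rewrite (_ : 'D_(ebasis j) _ = fun x =>
        'D_(ebasis (lift ord0 j)) f (rV_cons (a, x))); last exact/funext.
    by move=> x; exact: (continuous_comp (cons_contS a x) (cdf _)).
  + by move=> x Mx; apply: f0; exact: consMS.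
- rewrite I1; apply: integral0_eq => x _.
  have E a b : f (rV_cons (b *: (1 : R) + a, x)) =
      f (b *: ebasis ord0 + rV_cons (a, x)) by rewrite -rV_cons0E [b *: _]mulr1.
  have DE a : 'D_1 (fun b : R => f (rV_cons (b, x))) a =
      'D_(ebasis ord0) f (rV_cons (a, x)).
    by rewrite /derive; under eq_fun do rewrite /= E.
  transitivity (\int[lebesgue_measure]_a ('D_1 (fun b : R => f (rV_cons (b, x))) a)%:E)%E.
    by apply: eq_integral => a _; rewrite /= DE.
  apply: (@integral_derive1_supp _ M).
  + move=> a; have := df (rV_cons (a, x)); rewrite /derivable.
    by under [in X in _ -> X]eq_fun do rewrite /= E.
  + rewrite (_ : 'D_1 (fun b : R => f (rV_cons (b, x))) = fun a =>
        'D_(ebasis ord0) f (rV_cons (a, x))); last exact/funext.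
    by move=> a; exact: (continuous_comp (cons_cont0 x a) (cdf _)).
  + by move=> a Ma; apply: f0; exact: consM0.
Unshelve. all: by end_near. Qed.

End integration_by_parts.

(** * Hardy's inequality for test functions *)

Section hardy_test.
Context {R : realType} {N : nat}.
Implicit Types (x y : 'rV[R]_N) (f : 'rV[R]_N -> R).

Lemma dotv_ge0 x : 0 <= dotv x x.
Proof. by apply: sumr_ge0 => i _; rewrite -expr2 sqr_ge0. Qed.

Lemma enorm_sqr x : enorm x ^+ 2 = dotv x x.
Proof. by rewrite sqr_sqrtr ?dotv_ge0. Qed.

Lemma dotv_eq0 x : dotv x x = 0 -> x = 0.
Proof.
move/eqP; rewrite psumr_eq0 => [/allP x0|i _]; last by rewrite -expr2 sqr_ge0.
apply/rowP => i; rewrite mxE; have := x0 i.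
by rewrite mem_index_enum mulf_eq0 orbb => /(_ isT)/eqP.
Qed.

Lemma continuous_dotv : continuous (fun x => dotv x x).
Proof.
apply: (@continuous_big _ _ +%R 0 _ _ _ _ (fun (i : 'I_N) x => x ord0 i * x ord0 i)).
  exact: add_continuous.
move=> i _ x; have c : {for x, continuous (fun y : 'rV[R]_N => y ord0 i)}.
  exact: coord_continuous.
exact: (cvgM c c).
Qed.

Lemma is_derive_coord (i j : 'I_N) x :
  is_derive x (ebasis i) (fun y : 'rV[R]_N => y ord0 j) (i == j)%:R.
Proof.
have E (h : R) : h != 0 ->
    h^-1 *: ((h *: ebasis i + x) ord0 j - x ord0 j) = (i == j)%:R.
  by move=> h0; rewrite /ebasis !mxE /= addrK [_ *: _]mulKf// eq_sym.
apply: DeriveDef.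
- apply: (is_cvg_near_cst ((i == j)%:R : R)) => //=; near=> h; apply: E.
  by near: h; exact: nbhs_dnbhs_neq.
- apply/lim_near_cst => //=; near=> h; apply: E.
  by near: h; exact: nbhs_dnbhs_neq.
Unshelve. all: by end_near. Qed.

Lemma is_derive_dotv (i : 'I_N) x :
  is_derive x (ebasis i) (fun y : 'rV[R]_N => dotv y y) (2 * x ord0 i).
Proof.
pose X j : 'rV[R]_N -> R := fun y => y ord0 j.
have := @is_derive_sum _ _ _ N (fun j => X j * X j) x (ebasis i) _ (fun j =>
  is_deriveM (is_derive_coord i j x) (is_derive_coord i j x)).
rewrite fct_sumE (_ : (fun y => \sum_j _) = (fun y : 'rV[R]_N => dotv y y)); last first.
  by apply/funext => y; apply: eq_bigr.
move=> H; apply: is_derive_eq H _.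
rewrite (bigD1 i)//= big1 ?addr0 ?eqxx => [|j /negPf ji].
  by rewrite -[_ *: _]/(_ * _) mulr1; ring.
by rewrite eq_sym ji -[_ *: _]/(_ * _) mulr0 addr0.
Qed.

(** The vector field [f^2 x / (|x|^2 + e)], coordinate by coordinate.  Its
    divergence integrates to zero; [e] removes the singularity at the origin. *)
Definition hardy_field f (e : R) (i : 'I_N) x : R :=
  f x ^+ 2 * (x ord0 i / (dotv x x + e)).

Definition hardy_partial f (e : R) (i : 'I_N) x : R :=
  2 * f x * 'D_(ebasis i) f x * (x ord0 i / (dotv x x + e)) +
  f x ^+ 2 * ((dotv x x + e)^-1 - 2 * x ord0 i ^+ 2 / (dotv x x + e) ^+ 2).

Section test_field.
Variables (f : 'rV[R]_N -> R) (e M : R).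
Hypotheses (e0 : 0 < e) (cf : continuous f)
  (df : forall i x, derivable f x (ebasis i))
  (cdf : forall i, continuous ('D_(ebasis i) f))
  (f0 : forall x, M < `|x| -> f x = 0).

Lemma dotvD_gt0 x : 0 < dotv x x + e.
Proof. by rewrite ltr_wpDl// dotv_ge0. Qed.

Lemma is_derive_hardy_field i x :
  is_derive x (ebasis i) (hardy_field f e i) (hardy_partial f e i x).
Proof.
have d0 y : dotv y y + e != 0 by rewrite gt_eqF ?dotvD_gt0.
have dr : is_derive x (ebasis i) (fun y : 'rV[R]_N => dotv y y + e) (2 * x ord0 i).
  by apply: is_derive_eq (is_deriveD (is_derive_dotv i x) (is_derive_cst e x _)) _; rewrite addr0.
have di : is_derive x (ebasis i) (fun y : 'rV[R]_N => (dotv y y + e)^-1)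
    (- (dotv x x + e) ^- 2 * (2 * x ord0 i)).
  apply: DeriveDef; first by apply: derivableV => //; case: dr.
  by rewrite deriveV//; case: dr => // _ ->.
have dx := is_deriveM (is_derive_coord i i x) di.
have := is_deriveM (is_deriveX 2 (derivableP (@df i x))) dx.
move=> H; apply: is_derive_eq H _.
rewrite /hardy_partial eqxx -![_ *: _]/(_ * _) /=.
rewrite exprfctE !mulrfctE /= expr1.
field.
by rewrite d0.
Qed.

Let cM (g h : 'rV[R]_N -> R) :
  continuous g -> continuous h -> continuous (fun x => g x * h x).
Proof. by move=> cg ch x; exact: (cvgM (cg x) (ch x)). Qed.

Let cX2 (g : 'rV[R]_N -> R) : continuous g -> continuous (fun x => g x ^+ 2).
Proof. by move=> cg; under eq_fun do rewrite expr2; exact: cM. Qed.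

Let continuous_coord (i : 'I_N) : continuous (fun x : 'rV[R]_N => x ord0 i).
Proof. exact: coord_continuous. Qed.

Lemma continuous_invw : continuous (fun x : 'rV[R]_N => (dotv x x + e)^-1).
Proof.
move=> x; have c : {for x, continuous (fun y : 'rV[R]_N => dotv y y + e)}.
  exact: (cvgD (continuous_dotv (x := x)) (cvg_cst e)).
by apply: (cvgV _ c); apply: lt0r_neq0; exact: dotvD_gt0.
Qed.

Lemma continuous_hardy_weight : continuous (fun x => f x ^+ 2 / (dotv x x + e)).
Proof. by apply: cM; [exact: cX2|exact: continuous_invw]. Qed.

Lemma continuous_hardy_field i : continuous (hardy_field f e i).
Proof.
apply: cM; first exact: cX2.
by apply: cM; [exact: continuous_coord|exact: continuous_invw].
Qed.

Lemma continuous_hardy_partial i : continuous (hardy_partial f e i).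
Proof.
have c2 : continuous ((fun=> 2) : 'rV[R]_N -> R) by move=> x; exact: cst_continuous.
have c1 : continuous (fun x : 'rV[R]_N =>
    2 * f x * 'D_(ebasis i) f x * (x ord0 i / (dotv x x + e))).
  apply: cM; last by apply: cM; [exact: continuous_coord|exact: continuous_invw].
  exact: (cM (cM c2 cf) (@cdf i)).
have c3 : continuous (fun x : 'rV[R]_N =>
    2 * x ord0 i ^+ 2 / (dotv x x + e) ^+ 2).
  apply: cM; first by apply: (cM c2); apply: cX2; exact: continuous_coord.
  by under eq_fun do rewrite -exprVn; apply: cX2; exact: continuous_invw.
have c4 : continuous (fun x : 'rV[R]_N => f x ^+ 2 *
    ((dotv x x + e)^-1 - 2 * x ord0 i ^+ 2 / (dotv x x + e) ^+ 2)).
  apply: cM; first exact: cX2.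
  by move=> x; exact: (cvgB (continuous_invw (x := x)) (c3 x)).
by move=> x; exact: (cvgD (c1 x) (c4 x)).
Qed.

Lemma continuous_enorm_egrad : continuous (fun x => enorm (egrad f x) ^+ 2).
Proof.
under eq_fun do rewrite enorm_sqr /dotv.
apply: (@continuous_big _ _ +%R 0 _ _ _ _
    (fun (i : 'I_N) x => egrad f x ord0 i * egrad f x ord0 i)).
  exact: add_continuous.
move=> i _; under eq_fun do rewrite mxE; exact: cM.
Qed.

(** The divergence of [hardy_field] contains [(N - 2) f^2 / (|x|^2 + e)], up to a
    nonnegative term, and a product with [grad f] that the inequality between
    the arithmetic and geometric means splits into half of that term and a
    multiple of [|grad f|^2]. *)
Lemma hardy_test : (3 <= N)%N ->
  \int[leb N]_x (f x ^+ 2 / (dotv x x + e)) <=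
    4 / (N%:R - 2) ^+ 2 * \int[leb N]_x (enorm (egrad f x) ^+ 2).
Proof.
move=> N3; set c : R := N%:R - 2.
have c0 : 0 < c by rewrite subr_gt0 ltr_nat.
have fX0 x : M < `|x| -> f x ^+ 2 = 0 by move=> /f0 ->; rewrite expr0n.
have i1 : (leb N).-integrable setT (EFin \o (fun x => f x ^+ 2 / (dotv x x + e))).
  apply: (@continuous_supp_integrable _ _ _ M).
    exact: continuous_hardy_weight.
  by move=> x /fX0 ->; rewrite mul0r.
have i2 : (leb N).-integrable setT (EFin \o (fun x => enorm (egrad f x) ^+ 2)).
  apply: (@continuous_supp_integrable _ _ _ M).
    exact: continuous_enorm_egrad.
  move=> x Mx; rewrite enorm_sqr /dotv big1// => i _.
  by rewrite mxE (derive_supp _ f0 Mx) mul0r.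
have ip i : (leb N).-integrable setT (EFin \o hardy_partial f e i).
  apply: (@continuous_supp_integrable _ _ _ M); first exact: continuous_hardy_partial.
  by move=> x Mx; rewrite /hardy_partial fX0// f0//; ring.
have p0 i : (\int[leb N]_x (hardy_partial f e i x)%:E = 0)%E.
  have -> : hardy_partial f e i = 'D_(ebasis i) (hardy_field f e i).
    by apply/funext => x; have [_ ->] := is_derive_hardy_field i x.
  apply: (@integral_partial0 _ _ _ _ M).
  - exact: continuous_hardy_field.
  - by move=> x; have [] := is_derive_hardy_field i x.
  - rewrite (_ : 'D_(ebasis i) _ = hardy_partial f e i).
      exact: continuous_hardy_partial.
    by apply/funext => x; have [_ ->] := is_derive_hardy_field i x.
  - by move=> x Mx; rewrite /hardy_field fX0// mul0r.
have key x : c / 2 * (f x ^+ 2 / (dotv x x + e)) - 2 / c * enorm (egrad f x) ^+ 2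
    <= \sum_(i < N) hardy_partial f e i x.
  set w := (dotv x x + e)^-1.
  have w0 : 0 < w by rewrite invr_gt0 dotvD_gt0.
  have rw1 : dotv x x * w <= 1.
    by rewrite ler_pdivrMr ?dotvD_gt0// mul1r lerDl ltW.
  (* [t i] replaces the mixed term of [hardy_partial f e i] by two squares. *)
  pose t (i : 'I_N) : R := - (c / 2 * (f x ^+ 2 * w ^+ 2)) * (x ord0 i * x ord0 i)
    - 2 / c * (egrad f x ord0 i * egrad f x ord0 i)
    + f x ^+ 2 * w - 2 * f x ^+ 2 * w ^+ 2 * (x ord0 i * x ord0 i).
  apply: (@le_trans _ _ (\sum_(i < N) t i)).
    rewrite /t !big_split/= !sumrN -!mulr_sumr -/(dotv x x) -/(dotv _ _).
    rewrite sumr_const card_ord -[_ *+ N]mulr_natr (_ : N%:R = c + 2); last first.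
      by rewrite /c subrK.
    have := mulr_ge0 (mulr_ge0 (sqr_ge0 (f x)) (ltW w0)) (_ : 0 <= 1 - dotv x x * w).
    rewrite subr_ge0 => /(_ rw1) h.
    have : 0 <= (2 + c / 2) * (f x ^+ 2 * w * (1 - dotv x x * w)).
      by rewrite mulr_ge0// addr_ge0 ?divr_ge0 ?ltW.
    move=> {}h; rewrite -subr_ge0; apply: le_trans h _.
    by rewrite !enorm_sqr; apply: le_of_eq; field; exact: lt0r_neq0.
  apply: ler_sum => i _; rewrite /t /hardy_partial mxE -/w.
  set d := 'D_(ebasis i) f x.
  have : 0 <= 2 / c * (d + c / 2 * (f x * x ord0 i * w)) ^+ 2.
    by rewrite mulr_ge0 ?divr_ge0 ?sqr_ge0 ?ltW.
  rewrite -subr_ge0 => /le_trans; apply.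
  rewrite -exprVn -/w; apply: le_of_eq; field.
  exact: lt0r_neq0.
have i3 : (leb N).-integrable setT (EFin \o (fun x =>
  c / 2 * (f x ^+ 2 / (dotv x x + e)) - 2 / c * enorm (egrad f x) ^+ 2)).
  exact: (integrableB measurableT (integrableZl measurableT (c / 2) i1)
    (integrableZl measurableT (2 / c) i2)).
have i4 : (leb N).-integrable setT
    (fun x => (\sum_(i <- index_enum 'I_N) (hardy_partial f e i x)%:E)%E).
  by apply: integrable_sum => // i _; exact: ip.
have i4' : (leb N).-integrable setT (EFin \o (fun x => \sum_(i < N) hardy_partial f e i x)).
  by apply: eq_integrable i4 => // x _; rewrite /= sumEFin.
have := le_Rintegral measurableT i3 i4' (fun x _ => key x).
have -> : \int[leb N]_x (\sum_(i < N) hardy_partial f e i x) = 0.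
  rewrite /Rintegral; under eq_integral do rewrite -sumEFin.
  by rewrite integral_sum// big1.
rewrite RintegralB//; last 2 first.
- exact: (integrableZl measurableT (c / 2) i1).
- exact: (integrableZl measurableT (2 / c) i2).
rewrite !RintegralZl// subr_le0 -(ler_pM2l (_ : 0 < 2 / c)) ?divr_gt0//.
rewrite !mulrA (_ : 2 / c * c / 2 = 1) ?mul1r; last by field; exact: lt0r_neq0.
by rewrite (_ : 2 / c * 2 / c = 4 / c ^+ 2)//; field; exact: lt0r_neq0.
Qed.

End test_field.
End hardy_test.

(** * Test functions *)

Section test_functions.
Context {R : realType} {N : nat}.
Implicit Types (x y : 'rV[R]_N) (f g : 'rV[R]_N -> R) (Om : set 'rV[R]_N).

Lemma dotv_add_le x y : dotv (x + y) (x + y) <= 2 * dotv x x + 2 * dotv y y.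
Proof.
rewrite /dotv !mulr_sumr -big_split/=; apply: ler_sum => i _; rewrite !mxE.
by have := sqr_ge0 (x ord0 i - y ord0 i); nra.
Qed.

Lemma dotvZ (c : R) x : dotv (c *: x) (c *: x) = c ^+ 2 * dotv x x.
Proof.
by rewrite /dotv mulr_sumr; apply: eq_bigr => i _; rewrite !mxE; ring.
Qed.

Lemma Ccinfty_continuous Om f : Ccinfty Om f -> continuous f.
Proof. by case=> /(_ [::])[]. Qed.

Lemma Ccinfty_derivable Om f : Ccinfty Om f -> forall i x, derivable f x (ebasis i).
Proof. by case=> /(_ [::])[]. Qed.

Lemma Ccinfty_continuous_partial Om f : Ccinfty Om f ->
  forall i, continuous ('D_(ebasis i) f).
Proof. by case=> sf _ _ i; have [] := sf [:: i]. Qed.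

Lemma Ccinfty_supp Om f : Ccinfty Om f ->
  exists M : R, forall x, M < `|x| -> f x = 0.
Proof.
case=> _ /compact_bounded [M [_ hM]] _; exists (M + 1) => x Mx.
apply/eqP/negPn/negP => fx; have := hM (M + 1) _ x.
rewrite ltrDl ltr01 => /(_ isT) /=; rewrite leNgt Mx => /(_ _)/negP; apply => //.
by apply: subset_closure.
Qed.

Lemma Ccinfty_out Om f : Ccinfty Om f -> forall x, ~ Om x -> f x = 0.
Proof.
case=> _ _ sOm x; apply: contra_notP => /eqP fx; apply: sOm.
exact: subset_closure.
Qed.

Lemma Ccinfty_egrad_out Om f : Ccinfty Om f -> forall x, ~ Om x -> egrad f x = 0.
Proof.
case=> _ _ sOm x nOm; apply/rowP => i; rewrite !mxE.
rewrite (@near_eq_derive _ _ _ f (cst 0)) ?derive_cst//.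
have : ~ support_of f x by move=> /sOm.
move=> nsf; have : nbhs x (~` support_of f).
  apply: open_nbhs_nbhs; split => //; apply: closed_openC; exact: closed_closure.
apply: filterS => y nsy; apply/eqP/negPn/negP => fy; apply: nsy.
exact: subset_closure.
Qed.

Lemma Ccinfty_lin Om f g (c d : R) : Ccinfty Om f -> Ccinfty Om g ->
  Ccinfty Om (c \*: f + d \*: g) /\
  egrad (c \*: f + d \*: g) = c \*: egrad f + d \*: egrad g.
Proof.
move=> [sf kf fOm] [sg kg gOm].
have E l : iter_partial l (c \*: f + d \*: g) =
    c \*: iter_partial l f + d \*: iter_partial l g.
  elim: l => [//|i l IH] /=; apply/funext => x.
  have [_ df] := sf l; have [_ dg] := sg l.
  rewrite -/(iter_partial _ _) IH deriveD; [|exact: derivableZ..].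
  by rewrite !deriveZ.
have hs : support_of (c \*: f + d \*: g) `<=` support_of f `|` support_of g.
  rewrite /support_of -closureU; apply: closure_subset => x /= h.
  have [fx|] := eqVneq (f x) 0; last by left.
  have [gx|] := eqVneq (g x) 0; last by right.
  by move: h; rewrite -[(_ + _) _]/(c * f x + d * g x) fx gx !mulr0 addr0 eqxx.
split; last first.
  apply/funext => x; apply/rowP => i; rewrite !mxE.
  have [_ df] := sf [::]; have [_ dg] := sg [::].
  by rewrite deriveD; [rewrite !deriveZ|exact: derivableZ..].
split.
- move=> l; rewrite E; have [cf df] := sf l; have [cg dg] := sg l; split.
    by move=> x; exact: (cvgD (@cvgZr _ _ _ _ _ c _ _ (cf x)) (@cvgZr _ _ _ _ _ d _ _ (cg x))).
  by move=> i x; apply: derivableD; exact: derivableZ.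
- apply: (subclosed_compact _ _ hs); first exact: closed_closure.
  by apply: compactU.
- by apply: subset_trans hs _; rewrite subUset.
Qed.

End test_functions.

(** * Integrals of real-valued functions *)

Section real_integrals.
Context d {T : measurableType d} {R : realType}.
Variables (mu : {measure set T -> \bar R}) (D : set T).
Hypothesis mD : measurable D.
Implicit Types f g : T -> R.

Local Notation integrable f := (mu.-integrable D (EFin \o f)).

Lemma EFin_Rintegral f : integrable f ->
  (\int[mu]_(x in D) (f x)%:E = (\int[mu]_(x in D) f x)%:E)%E.
Proof. by move=> fi; rewrite /Rintegral fineK//; exact: integrable_fin_num. Qed.

Lemma ge0_integrable f : measurable_fun D f -> (forall x, D x -> 0 <= f x) ->
  (\int[mu]_(x in D) (f x)%:E < +oo)%E -> integrable f.
Proof.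
move=> mf f0 foo; apply/integrableP; split; first exact/measurable_EFinP.
rewrite (eq_integral (EFin \o f))// => x; rewrite inE => Dx.
by rewrite /= ger0_norm ?f0.
Qed.

Lemma le_ge0_integrable f g : measurable_fun D f ->
  (forall x, D x -> 0 <= f x <= g x) -> integrable g -> integrable f.
Proof.
move=> mf fg; apply: le_integrable => //; first exact/measurable_EFinP.
move=> x Dx; have /andP[f0 fgx] := fg x Dx.
by rewrite /= !ger0_norm ?(le_trans f0)// lee_fin.
Qed.

Lemma integrableZ f (c : R) : integrable f -> integrable (fun x => c * f x).
Proof. by move=> fi; exact: (integrableZl mD c fi). Qed.

Lemma integrable_add f g : integrable f -> integrable g ->
  integrable (fun x => f x + g x).
Proof. by move=> fi gi; exact: (integrableD mD fi gi). Qed.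

Lemma integrable_lin f g (a b : R) : integrable f -> integrable g ->
  integrable (fun x => a * f x + b * g x).
Proof. by move=> fi gi; apply: integrable_add; exact: integrableZ. Qed.

Lemma Rintegral_lin f g (a b : R) : integrable f -> integrable g ->
  \int[mu]_(x in D) (a * f x + b * g x) =
  a * \int[mu]_(x in D) f x + b * \int[mu]_(x in D) g x.
Proof.
by move=> fi gi; rewrite RintegralD ?RintegralZl//; exact: integrableZ.
Qed.

Lemma Rintegral0_ae f : integrable f -> (forall x, D x -> 0 <= f x) ->
  \int[mu]_(x in D) f x = 0 -> {ae mu, forall x, D x -> f x = 0}.
Proof.
move=> fi f0 If.
have mf : measurable_fun D (EFin \o f) by exact: measurable_int fi.
have : (\int[mu]_(x in D) `|(EFin \o f) x| = 0)%E.
  rewrite (eq_integral (EFin \o f)) => [|x]; first by rewrite EFin_Rintegral// If.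
  by rewrite inE => Dx; rewrite /= ger0_norm ?f0.
move/(ae_eq_integral_abs _ mD mf); apply: filterS => x h Dx.
by have /= := h Dx => -[].
Qed.

End real_integrals.

(** * The space [D012] *)

Section D012_theory.
Context {R : realType} {N : nat}.
Variable Om : set 'rV[R]_N.
Hypotheses (N3 : (3 <= N)%N) (oOm : open Om).
Implicit Types (u v : fgrad R N).

Let mOm : measurable Om. Proof. exact: open_measurable_rV. Qed.

Local Notation q := (@critical_sobolev R N).
Local Notation integrable f := ((leb N).-integrable Om (EFin \o f)).

Lemma measurable_dotv (D : set 'rV[R]_N) (F G : 'rV[R]_N -> 'rV[R]_N) :
  (forall i, measurable_fun D (fun x => F x ord0 i)) ->
  (forall i, measurable_fun D (fun x => G x ord0 i)) ->
  measurable_fun D (fun x => dotv (F x) (G x)).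
Proof.
move=> mF mG; apply: (@measurable_sum _ _ _ _ _ _ (fun i x => F x ord0 i * G x ord0 i)) => i.
exact: measurable_funM.
Qed.

Lemma measurable_enorm2 (D : set 'rV[R]_N) (F : 'rV[R]_N -> 'rV[R]_N) :
  (forall i, measurable_fun D (fun x => F x ord0 i)) ->
  measurable_fun D (fun x => enorm (F x) ^+ 2).
Proof. by move=> mF; under eq_fun do rewrite enorm_sqr; exact: measurable_dotv. Qed.

Lemma measurable_normpow (D : set 'rV[R]_N) (f : 'rV[R]_N -> R) r :
  measurable_fun D f -> measurable_fun D (fun x => `|f x| `^ r).
Proof.
move=> mf; apply: (measurableT_comp (measurable_powR r)).
exact: measurableT_comp.
Qed.

Lemma Ccinfty_measurable f : Ccinfty Om f -> measurable_fun Om f.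
Proof.
move/Ccinfty_continuous/continuous_measurable_rV; exact: measurable_funS.
Qed.

Lemma Ccinfty_egrad_measurable f : Ccinfty Om f ->
  forall i, measurable_fun Om (fun x => egrad f x ord0 i).
Proof.
move=> tf i; under eq_fun do rewrite mxE.
have := continuous_measurable_rV (Ccinfty_continuous_partial tf (i := i)).
exact: measurable_funS.
Qed.

Lemma N2_gt0 : 0 < N%:R - 2 :> R.
Proof. by rewrite subr_gt0 ltr_nat. Qed.

Lemma critical_sobolev_gt2 : 2 < q.
Proof.
rewrite /critical_sobolev ltr_pdivlMr ?N2_gt0//; lra.
Qed.

Let q_gt0 : 0 < q.
Proof. by apply: lt_trans critical_sobolev_gt2. Qed.

Lemma Ccinfty_integrable f : Ccinfty Om f ->
  integrable (fun x => `|f x| `^ q) /\ integrable (fun x => enorm (egrad f x) ^+ 2).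
Proof.
move=> tf; have [M f0] := Ccinfty_supp tf; have cf := Ccinfty_continuous tf.
have [K fK] := continuous_supp_bounded cf f0.
split; apply: (@integrableS _ _ _ _ setT) => //.
- apply: (@bounded_supp_integrable _ _ _ M (K `^ q)).
  + by apply: measurable_normpow; exact: continuous_measurable_rV.
  + move=> x; rewrite ger0_norm ?powR_ge0//.
    apply: ge0_ler_powR => //; rewrite ?nnegrE//; first exact: ltW.
    exact: le_trans (fK x).
  + by move=> x /f0 ->; rewrite normr0 powR0// gt_eqF.
- apply: (@continuous_supp_integrable _ _ _ M).
    exact: continuous_enorm_egrad (Ccinfty_continuous_partial tf).
  move=> x Mx; rewrite enorm_sqr /dotv big1// => i _.
  by rewrite mxE (derive_supp _ f0 Mx) mul0r.
Qed.

(** The form in which membership is used and proved below: approximation up to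
    a given error, with integrability made explicit, since the real-valued
    integral alone does not detect infinite values. *)
Lemma D012P u : D012 Om u <->
  [/\ measurable_fun Om u.1,
      forall i, measurable_fun Om (fun x => u.2 x ord0 i)
    & forall e : R, 0 < e -> exists f, [/\ Ccinfty Om f,
        integrable (fun x => `|f x - u.1 x| `^ q),
        integrable (fun x => enorm (egrad f x - u.2 x) ^+ 2),
        \int[leb N]_(x in Om) (`|f x - u.1 x| `^ q) < e &
        \int[leb N]_(x in Om) (enorm (egrad f x - u.2 x) ^+ 2) < e]].
Proof.
split=> -[mu1 mu2 H]; split => //.
- move=> e e0; case: H => eta [teta c1 c2].
  have m1 k : measurable_fun Om (fun x => `|eta k x - u.1 x| `^ q).
    by apply: measurable_normpow; apply: measurable_funB => //; exact: Ccinfty_measurable.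
  have m2 k : measurable_fun Om (fun x => enorm (egrad (eta k) x - u.2 x) ^+ 2).
    apply: measurable_enorm2 => i.
    rewrite (_ : (fun x => _) = (fun x => egrad (eta k) x ord0 i - u.2 x ord0 i)).
      by apply: measurable_funB => //; exact: Ccinfty_egrad_measurable.
    by apply/funext => x; rewrite !mxE.
  have e0' : nbhs (0 : \bar R)%E [set y | (y < e%:E)%E].
    by apply: open_nbhs_nbhs; split; [exact: open_ereal_lt_ereal|rewrite /= lte_fin].
  have n1 : \forall k \near \oo,
      (\int[leb N]_(x in Om) (`|eta k x - u.1 x| `^ q)%:E < e%:E)%E := c1 _ e0'.
  have n2 : \forall k \near \oo, (\int[leb N]_(x in Om)
      (enorm (egrad (eta k) x - u.2 x) ^+ 2)%:E < e%:E)%E := c2 _ e0'.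
  have [k0 _ /(_ k0 (leqnn k0)) [/= h1 h2]] := filterI n1 n2.
  have i1 := ge0_integrable (m1 k0) (fun x _ => powR_ge0 _ _) (lt_trans h1 (ltry _)).
  have i2 := ge0_integrable (m2 k0) (fun x _ => sqr_ge0 _) (lt_trans h2 (ltry _)).
  exists (eta k0); split => //.
  + by rewrite -lte_fin -EFin_Rintegral.
  + by rewrite -lte_fin -EFin_Rintegral.
- have k0 (k : nat) : 0 < k.+1%:R^-1 :> R by rewrite invr_gt0.
  have /choice[eta heta] k := H _ (k0 k).
  have c0 : (fun k : nat => (k.+1%:R^-1 : R)%:E) @ \oo --> 0%E by exact: cvge_harmonic.
  exists eta; split=> [k||]; first by have [] := heta k.
  + apply: squeeze_cvge (cvg_cst 0%E) c0; apply: nearW => k.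
    have [_ i1 _ l1 _] := heta k.
    apply/andP; split; first by apply: integral_ge0 => x _; rewrite lee_fin powR_ge0.
    by rewrite EFin_Rintegral// lee_fin ltW.
  + apply: squeeze_cvge (cvg_cst 0%E) c0; apply: nearW => k.
    have [_ _ i2 _ l2] := heta k.
    apply/andP; split; first by apply: integral_ge0 => x _; rewrite lee_fin sqr_ge0.
    by rewrite EFin_Rintegral// lee_fin ltW.
Qed.

Lemma powR_norm_add (a b : R) : `|a + b| `^ q <= 2 `^ q * (`|a| `^ q + `|b| `^ q).
Proof.
have ab : `|a + b| <= 2 * Num.max `|a| `|b|.
  rewrite (le_trans (ler_normD _ _))// mulr_natl mulr2n lerD// le_max lexx ?orbT//.
apply: (@le_trans _ _ ((2 * Num.max `|a| `|b|) `^ q)).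
  apply: ge0_ler_powR => //; rewrite ?nnegrE//; exact: ltW.
rewrite powRM ?le_max ?normr_ge0// ler_wpM2l ?powR_ge0//.
by rewrite maxEle; case: ifP => _; rewrite ?lerDl ?lerDr powR_ge0.
Qed.

Lemma D012_lin u v (c d : R) : D012 Om u -> D012 Om v -> D012 Om (c *: u + d *: v).
Proof.
move=> /D012P[mu1 mu2 Hu] /D012P[mv1 mv2 Hv]; apply/D012P; split.
- rewrite -[(_ + _).1]/(fun x => c * u.1 x + d * v.1 x).
  by apply: measurable_funD; apply: measurable_funM.
- move=> i; rewrite (_ : (fun x => _) = (fun x => c * u.2 x ord0 i + d * v.2 x ord0 i)).
    by apply: measurable_funD; apply: measurable_funM.
  by apply/funext => x; rewrite !mxE.
move=> e e0.
pose K1 : R := 2 `^ q * `|c| `^ q; pose K2 : R := 2 `^ q * `|d| `^ q.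
(* [K] dominates both error factors at once; [+ 1] keeps it positive. *)
pose K : R := K1 + K2 + 2 * c ^+ 2 + 2 * d ^+ 2 + 1.
have K10 : 0 <= K1 by rewrite mulr_ge0 ?powR_ge0.
have K20 : 0 <= K2 by rewrite mulr_ge0 ?powR_ge0.
have c20 := sqr_ge0 c; have d20 := sqr_ge0 d.
have K0 : 0 < K by rewrite /K; lra.
have K12 : K1 + K2 < K by rewrite /K; lra.
have Kcd : 2 * c ^+ 2 + 2 * d ^+ 2 < K by rewrite /K; lra.
have c22 : 0 <= 2 * c ^+ 2 by lra.
have d22 : 0 <= 2 * d ^+ 2 by lra.
have eE : e = K * (e / K) by rewrite mulrC divfK// gt_eqF.
have eK0 : 0 < e / K by rewrite divr_gt0.
have [f [tf f1 f2 lf1 lf2]] := Hu _ eK0.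
have [g [tg g1 g2 lg1 lg2]] := Hv _ eK0.
have [tfg gfg] := Ccinfty_lin c d tf tg.
exists (c \*: f + d \*: g).
have le1 x : 0 <= `|(c \*: f + d \*: g) x - (c *: u + d *: v).1 x| `^ q <=
    K1 * `|f x - u.1 x| `^ q + K2 * `|g x - v.1 x| `^ q.
  rewrite powR_ge0/=.
  rewrite (_ : _ - _ = c * (f x - u.1 x) + d * (g x - v.1 x)); last first.
    by rewrite -[LHS]/(c * f x + d * g x - (c * u.1 x + d * v.1 x)); ring.
  rewrite (le_trans (powR_norm_add _ _))// !normrM !powRM ?normr_ge0//.
  by rewrite /K1 /K2 mulrDr !mulrA.
have le2 x : 0 <= enorm (egrad (c \*: f + d \*: g) x - (c *: u + d *: v).2 x) ^+ 2 <=
    (2 * c ^+ 2) * enorm (egrad f x - u.2 x) ^+ 2 +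
    (2 * d ^+ 2) * enorm (egrad g x - v.2 x) ^+ 2.
  rewrite sqr_ge0/= gfg.
  rewrite (_ : _ - _ = c *: (egrad f x - u.2 x) + d *: (egrad g x - v.2 x)); last first.
    by apply/rowP => i; rewrite !mxE; ring.
  by rewrite !enorm_sqr (le_trans (dotv_add_le _ _))// !dotvZ !mulrA.
have j1 := integrable_lin mOm K1 K2 f1 g1.
have j2 := integrable_lin mOm (2 * c ^+ 2) (2 * d ^+ 2) f2 g2.
have i1 : integrable (fun x => `|(c \*: f + d \*: g) x - (c *: u + d *: v).1 x| `^ q).
  apply: (le_ge0_integrable mOm _ (fun x _ => le1 x) j1).
  apply: measurable_normpow; apply: measurable_funB; first exact: Ccinfty_measurable.
  rewrite -[(_ + _).1]/(fun x => c * u.1 x + d * v.1 x).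
  by apply: measurable_funD; apply: measurable_funM.
have i2 : integrable (fun x => enorm (egrad (c \*: f + d \*: g) x - (c *: u + d *: v).2 x) ^+ 2).
  apply: (le_ge0_integrable mOm _ (fun x _ => le2 x) j2).
  apply: measurable_enorm2 => i; rewrite (_ : (fun x => _) =
      (fun x => egrad (c \*: f + d \*: g) x ord0 i - (c * u.2 x ord0 i + d * v.2 x ord0 i))).
    apply: measurable_funB; first exact: Ccinfty_egrad_measurable.
    by apply: measurable_funD; apply: measurable_funM.
  by apply/funext => x; rewrite !mxE.
split; [exact: tfg|exact: i1|exact: i2| |].
- apply: le_lt_trans (le_Rintegral mOm i1 j1 _) _; first by move=> x _; case/andP: (le1 x).
  rewrite (Rintegral_lin mOm _ _ f1 g1) eE.
  apply: le_lt_trans (lerD (ler_wpM2l K10 (ltW lf1)) (ler_wpM2l K20 (ltW lg1))) _.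
  by rewrite -mulrDl (ltr_pM2r eK0).
- apply: le_lt_trans (le_Rintegral mOm i2 j2 _) _; first by move=> x _; case/andP: (le2 x).
  rewrite (Rintegral_lin mOm _ _ f2 g2) eE.
  apply: le_lt_trans (lerD (ler_wpM2l c22 (ltW lf2)) (ler_wpM2l d22 (ltW lg2))) _.
  by rewrite -mulrDl (ltr_pM2r eK0).
Qed.

Lemma D012Z u (c : R) : D012 Om u -> D012 Om (c *: u).
Proof. by move=> Du; have := D012_lin c 0 Du Du; rewrite scale0r addr0. Qed.

Lemma D012_add u v (t : R) : D012 Om u -> D012 Om v -> D012 Om (u + t *: v).
Proof. by move=> Du Dv; have := D012_lin 1 t Du Dv; rewrite scale1r. Qed.

Lemma D012_integrable u : D012 Om u ->
  integrable (fun x => `|u.1 x| `^ q) /\ integrable (fun x => enorm (u.2 x) ^+ 2).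
Proof.
move=> /D012P[mu1 mu2 /(_ 1 ltr01)[f [tf i1 i2 _ _]]].
have [f1 f2] := Ccinfty_integrable tf; split.
- apply: (le_ge0_integrable mOm _ _
    (integrable_lin mOm (2 `^ q) (2 `^ q) f1 i1)) => [|x _].
    exact: measurable_normpow.
  rewrite powR_ge0/= -mulrDr (_ : u.1 x = f x + - (f x - u.1 x)); last by ring.
  by rewrite (le_trans (powR_norm_add _ _))// normrN (_ : f x - (f x + _) = f x - u.1 x)//; ring.
- apply: (le_ge0_integrable mOm _ _ (integrable_lin mOm 2 2 f2 i2)) => [|x _].
    exact: measurable_enorm2.
  rewrite sqr_ge0/= !enorm_sqr.
  rewrite [X in dotv X X <= _](_ : u.2 x = egrad f x + (-1) *: (egrad f x - u.2 x)).
    by rewrite (le_trans (dotv_add_le _ _))// dotvZ sqrrN expr1n mul1r.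
  by rewrite scaleN1r opprB addrC subrK.
Qed.

End D012_theory.

(** * Hardy's inequality on [D012] *)

Section hardy_D012.
Context {R : realType} {N : nat}.
Variable Om : set 'rV[R]_N.
Hypotheses (N3 : (3 <= N)%N) (oOm : open Om).
Implicit Types (u v : fgrad R N).

Let mOm : measurable Om. Proof. exact: open_measurable_rV. Qed.

Local Notation q := (@critical_sobolev R N).
Local Notation integrable f := ((leb N).-integrable Om (EFin \o f)).
Local Notation rho x := (dotv x x).

(** This trades [L^2] control on a set of finite measure for [L^q] control, at the
    price of an error that is small with [a]. *)
Lemma sqr_le_powR (a y : R) : 0 < a -> 0 <= y ->
  y ^+ 2 <= a ^+ 2 + y `^ q / a `^ (q - 2).
Proof.
move=> a0 y0; have q2 := critical_sobolev_gt2 (R := R) N3.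
have [ya|ay] := leP y a.
  rewrite (@le_trans _ _ (a ^+ 2)) ?lerDl ?divr_ge0 ?powR_ge0//.
  by rewrite ler_sqr ?nnegrE// ltW.
rewrite (@le_trans _ _ (y `^ q / a `^ (q - 2))) ?lerDr ?sqr_ge0//.
have y0' : 0 < y by exact: lt_trans ay.
rewrite ler_pdivlMr ?powR_gt0// (_ : y `^ q = y ^+ 2 * y `^ (q - 2)); last first.
  rewrite -powR_mulrn// -powRD ?(gt_eqF y0') ?implybT//.
  by congr (_ `^ _); rewrite addrC subrK.
apply: ler_wpM2l; first exact: sqr_ge0.
by apply: ge0_ler_powR; rewrite ?nnegrE ?subr_ge0//; exact: ltW.
Qed.

Lemma hardy_Ccinfty f (e : R) : Ccinfty Om f -> 0 < e ->
  integrable (fun x => f x ^+ 2 / (rho x + e)) /\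
  \int[leb N]_(x in Om) (f x ^+ 2 / (rho x + e)) <=
    4 / (N%:R - 2) ^+ 2 * \int[leb N]_(x in Om) (enorm (egrad f x) ^+ 2).
Proof.
move=> tf e0; have [M f0] := Ccinfty_supp tf.
have cf := Ccinfty_continuous tf; have cdf := Ccinfty_continuous_partial tf.
split.
  apply: (@integrableS _ _ _ _ setT) => //.
  apply: (@continuous_supp_integrable _ _ _ M).
    exact: continuous_hardy_weight.
  by move=> x /f0 ->; rewrite expr0n mul0r.
rewrite Rintegral_mkcond [X in _ <= _ * X]Rintegral_mkcond.
have -> : (fun x => f x ^+ 2 / (rho x + e)) \_ Om = (fun x => f x ^+ 2 / (rho x + e)).
  apply/funext => x; rewrite patchE; case: ifPn => //; rewrite notin_setE => nOm.
  by rewrite (Ccinfty_out tf nOm) expr0n mul0r.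
have -> : (fun x => enorm (egrad f x) ^+ 2) \_ Om = (fun x => enorm (egrad f x) ^+ 2).
  apply/funext => x; rewrite patchE; case: ifPn => //; rewrite notin_setE => nOm.
  by rewrite (Ccinfty_egrad_out tf nOm) enorm_sqr /dotv big1// => i _; rewrite mxE mul0r.
exact: (hardy_test e0 cf (Ccinfty_derivable tf) cdf f0 N3).
Qed.

(** Four times the constant for test functions: a factor [2] is lost twice, when
    [u] and then its gradient are compared with those of an approximation. *)
Let hardyK : R := 16 / (N%:R - 2) ^+ 2.

(** The origin is removed so that [hardy_trunc] converges everywhere, including
    at the point where the division by [|x|^2] returns [0]. *)
Definition punctured_ball (n : nat) : set 'rV[R]_N :=
  [set y | `|y| <= n%:R] `\` [set y | `|y| <= 0].

Let measurable_punctured_ball n : measurable (punctured_ball n).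
Proof. by apply: measurableD; exact: measurable_norm_le. Qed.

Definition hardy_trunc u (n : nat) (x : 'rV[R]_N) : R :=
  u.1 x ^+ 2 / (rho x + n.+1%:R^-1) * \1_(punctured_ball n) x.

Lemma measurable_hardy_trunc u n : measurable_fun Om u.1 ->
  measurable_fun Om (hardy_trunc u n).
Proof.
move=> mu1; apply: measurable_funM; last first.
  by apply: measurable_indic; exact: measurable_punctured_ball.
apply: measurable_funM; first exact: measurable_funX.
apply: measurable_funS (continuous_measurable_rV _) => //.
by apply: continuous_invw; rewrite invr_gt0.
Qed.

(** The weight of [hardy_trunc] is at most [n + 1] and lives on a set of finite
    measure, so a test function close to [u] in [L^q] is also close in the
    weighted [L^2] norm, and its inequality passes to [u] up to any error [d]. *)
Lemma hardy_trunc_le u n : D012 Om u ->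
  (\int[leb N]_(x in Om) (hardy_trunc u n x)%:E <= (hardyK * dirichlet Om u)%:E)%E.
Proof.
move=> Du; have [mu1 mu2 Hu] := (D012P oOm u).1 Du.
have [_ ig] := D012_integrable N3 oOm Du.
set B := punctured_ball n.
have iB : integrable (\1_B).
  apply: (@integrableS _ _ _ _ setT) => //.
  apply: (@bounded_supp_integrable _ _ _ n%:R 1).
  - by apply: measurable_indic; exact: measurable_punctured_ball.
  - by move=> x; rewrite indicE; case: (_ \in _); rewrite ?normr1 ?normr0.
  - by move=> x nx; rewrite indicE memNset//= => -[/=]; rewrite leNgt nx.
set V := \int[leb N]_(x in Om) \1_B x.
have V0 : 0 <= V by apply: Rintegral_ge0 => x _.
set m : R := n.+1%:R; have m0 : 0 < m by rewrite ltr0n.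
apply/lee_addgt0Pr => d d0; rewrite -EFinD.
(* [a] is chosen so that the error [2 m a^2 V] is at most [d / 2]. *)
pose a := Num.sqrt (d / (4 * m * (V + 1))).
have a2 : a ^+ 2 = d / (4 * m * (V + 1)).
  by rewrite sqr_sqrtr// divr_ge0 ?mulr_ge0 ?addr_ge0// ltW.
have a0 : 0 < a by rewrite sqrtr_gt0 divr_gt0 ?mulr_gt0// ltr_wpDl.
have hV : 2 * m * a ^+ 2 * V <= d / 2.
  rewrite a2 -subr_ge0 (_ : _ - _ = d / 2 / (V + 1)); last first.
    by field; rewrite !gt_eqF// ltr_wpDl.
  by rewrite !divr_ge0 ?addr_ge0// ltW.
have K0 : 0 < hardyK by rewrite divr_gt0// exprn_gt0// N2_gt0.
set P := a `^ (q - 2); have P0 : 0 < P by rewrite powR_gt0.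
pose Bd := hardyK + 2 * m / P.
have mP0 : 0 < 2 * m / P by rewrite divr_gt0 ?mulr_gt0.
have Bd0 : 0 < Bd by rewrite addr_gt0.
have [f [tf i1 i2 l1 l2]] := Hu (d / 2 / Bd) (divr_gt0 (divr_gt0 d0 (ltr0n _ 2)) Bd0).
have mi0 : 0 < m^-1 by rewrite invr_gt0.
have [ih lh] := hardy_Ccinfty tf mi0.
have [_ if2] := Ccinfty_integrable N3 oOm tf.
have le x : 0 <= hardy_trunc u n x <=
    2 * (f x ^+ 2 / (rho x + m^-1)) + (2 * m / P * `|f x - u.1 x| `^ q + 2 * m * a ^+ 2 * \1_B x).
  rewrite /hardy_trunc -/m -/B; set w := (rho x + m^-1)^-1.
  have wm0 : 0 < rho x + m^-1 by rewrite ltr_wpDl ?dotv_ge0.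
  have w0 : 0 < w by rewrite invr_gt0.
  have wm : w <= m.
    by rewrite -(invrK m) lef_pV2 ?posrE// lerDr dotv_ge0.
  have Y0 : 0 <= `|f x - u.1 x| `^ q by exact: powR_ge0.
  have h1 : 0 <= f x ^+ 2 * w by rewrite mulr_ge0 ?sqr_ge0// ltW.
  have h2 : 0 <= 2 * m / P * `|f x - u.1 x| `^ q by rewrite mulr_ge0// ltW.
  have h3 : 0 <= 2 * m * a ^+ 2 by rewrite !mulr_ge0 ?sqr_ge0// ltW.
  rewrite indicE; case: (_ \in B); last by rewrite !mulr0 lexx/=; lra.
  rewrite /= !mulr1; apply/andP; split; first by rewrite mulr_ge0 ?sqr_ge0// ltW.
  have := sqr_le_powR a0 (normr_ge0 (f x - u.1 x)); rewrite real_normK ?num_real//.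
  rewrite -/P => hY.
  have h4 : u.1 x ^+ 2 * w <= 2 * (f x ^+ 2 * w) + 2 * (f x - u.1 x) ^+ 2 * w.
    rewrite -subr_ge0 (_ : _ - _ = (2 * f x - u.1 x) ^+ 2 * w); last by ring.
    by rewrite mulr_ge0 ?sqr_ge0// ltW.
  apply: le_trans h4 _; rewrite lerD2l.
  apply: (@le_trans _ _ (2 * (f x - u.1 x) ^+ 2 * m)).
    by apply: ler_wpM2l => //; rewrite mulr_ge0 ?sqr_ge0.
  apply: (@le_trans _ _ (2 * (a ^+ 2 + `|f x - u.1 x| `^ q / P) * m)).
    by rewrite ler_wpM2r ?ler_wpM2l// ltW.
  by apply: le_of_eq; field; exact: lt0r_neq0.
have ij := integrable_lin mOm (2 * m / P) (2 * m * a ^+ 2) i1 iB.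
have ik := integrable_add mOm (integrableZ mOm 2 ih) ij.
have il : integrable (hardy_trunc u n).
  by apply: (le_ge0_integrable mOm _ (fun x _ => le x) ik); exact: measurable_hardy_trunc.
rewrite EFin_Rintegral// lee_fin.
apply: le_trans (le_Rintegral mOm il ik _) _; first by move=> x _; case/andP: (le x).
rewrite RintegralD//; last exact: integrableZ.
rewrite Rintegral_lin// RintegralZl//.
have g2 : \int[leb N]_(x in Om) (enorm (egrad f x) ^+ 2) <=
    2 * dirichlet Om u + 2 * (\int[leb N]_(x in Om) enorm (egrad f x - u.2 x) ^+ 2).
  rewrite -Rintegral_lin//; apply: le_Rintegral => //; first exact: integrable_lin.
  move=> x _; rewrite !enorm_sqr.
  rewrite [X in dotv X X <= _](_ : _ = u.2 x + (egrad f x - u.2 x)) ?dotv_add_le//.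
  by rewrite addrC subrK.
move: lh g2 l1 l2; rewrite -/V.
set H := \int[leb N]_(x in Om) _; set F := \int[leb N]_(x in Om) _.
set I2 := \int[leb N]_(x in Om) _; set I1 := \int[leb N]_(x in Om) _ => lH lF l1 l2.
have -> : d = d / 2 + Bd * (d / 2 / Bd) by field; exact: lt0r_neq0.
have hI2 : hardyK * I2 <= hardyK * (d / 2 / Bd) by rewrite ler_pM2l// ltW.
have hI1 : 2 * m / P * I1 <= 2 * m / P * (d / 2 / Bd) by rewrite ler_pM2l// ltW.
have hF : hardyK / 4 * F <= hardyK / 4 * (2 * dirichlet Om u + 2 * I2).
  by rewrite ler_pM2l// divr_gt0.
have KE : 4 / (N%:R - 2) ^+ 2 * F = hardyK / 4 * F.
  by rewrite /hardyK; field; rewrite gt_eqF// N2_gt0.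
rewrite KE in lH.
rewrite /Bd mulrDl; lra.
Qed.

Lemma cvg_hardy_trunc_neq0 u x : x != 0 ->
  (hardy_trunc u n x)%:E @[n --> \oo] --> (u.1 x ^+ 2 / rho x)%:E.
Proof.
move=> x0; apply: cvg_EFin; first exact: nearW.
have r0 : rho x != 0.
  by apply: contra x0 => /eqP/dotv_eq0 ->.
have h : u.1 x ^+ 2 / (rho x + n.+1%:R^-1) @[n --> \oo] --> u.1 x ^+ 2 / rho x.
  apply: cvgM; first exact: cvg_cst.
  apply: cvgV => //; rewrite -[X in _ --> X]addr0.
  by apply: cvgD; [exact: cvg_cst|exact: cvg_harmonic].
apply: cvg_trans h; apply: near_eq_cvg; near=> n.
rewrite /= /hardy_trunc indicE mem_set ?mulr1//; split => /=.
  by near: n; exact: nbhs_infty_ger.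
by rewrite normr_le0; exact/negP.
Unshelve. all: by end_near. Qed.

Lemma cvg_hardy_trunc u x :
  (hardy_trunc u n x)%:E @[n --> \oo] --> (u.1 x ^+ 2 / rho x)%:E.
Proof.
have [->|x0] := eqVneq x 0; last exact: cvg_hardy_trunc_neq0.
rewrite (_ : (fun n => _) = fun=> 0%E); last first.
  apply/funext => n; rewrite /hardy_trunc indicE memNset ?mulr0//.
  by case=> _ /=; rewrite normr0 lexx.
by rewrite /dotv big1 ?invr0 ?mulr0 => [|i _]; [exact: cvg_cst|rewrite mxE mul0r].
Qed.

(** Fatou's lemma applied to the truncations, whose integrals are uniformly
    bounded. *)
Lemma hardy u : D012 Om u ->
  integrable (fun x => u.1 x ^+ 2 / rho x) /\
  \int[leb N]_(x in Om) (u.1 x ^+ 2 / rho x) <= hardyK * dirichlet Om u.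
Proof.
move=> Du; have [mu1 _ _] := (D012P oOm u).1 Du.
have mt n : measurable_fun Om (EFin \o hardy_trunc u n).
  by apply/measurable_EFinP; exact: measurable_hardy_trunc.
have t0 n x : Om x -> (0 <= (EFin \o hardy_trunc u n) x)%E.
  move=> _; rewrite lee_fin; apply: mulr_ge0 => //.
  by rewrite divr_ge0 ?sqr_ge0// addr_ge0 ?dotv_ge0// invr_ge0.
have f0 x : 0 <= u.1 x ^+ 2 / rho x by rewrite divr_ge0 ?sqr_ge0 ?dotv_ge0.
have mf : measurable_fun Om (fun x => u.1 x ^+ 2 / rho x).
  apply: measurable_funM; first exact: measurable_funX.
  rewrite (_ : (fun x => _) = (fun x => rho x `^ (-1))).
    apply: (measurableT_comp (measurable_powR (-1))).
    have := continuous_measurable_rV (@continuous_dotv R N); exact: measurable_funS.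
  by apply/funext => x; rewrite powR_inv1// dotv_ge0.
have le : (\int[leb N]_(x in Om) (u.1 x ^+ 2 / rho x)%:E <=
    (hardyK * dirichlet Om u)%:E)%E.
  apply: (@le_trans _ _ (limn_einf (fun n =>
      \int[leb N]_(x in Om) (EFin \o hardy_trunc u n) x)%E)).
    apply: le_trans (fatou (leb N) mOm mt t0).
    apply: le_of_eq; apply: eq_integral => x _.
    by have [-> _] := cvg_limn_einf_sup (cvg_hardy_trunc (u := u) (x := x)).
  rewrite limn_einf_lim; apply: lime_le; first exact: is_cvg_einfs.
  apply: nearW => n; apply: le_trans (ereal_inf_lbound _) (hardy_trunc_le n Du).
  by exists n => /=.
have fi := ge0_integrable mf (fun x _ => f0 x) (le_lt_trans le (ltry _)).
by split => //; rewrite -lee_fin -EFin_Rintegral.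
Qed.

End hardy_D012.

(** * Young's inequality *)

Lemma powR_div (R : realType) (y e r : R) : 0 <= y -> 0 < e ->
  (y / e) `^ r = y `^ r / e `^ r.
Proof.
move=> y0 e0; have {}e0 := ltW e0.
by rewrite powRM ?invr_ge0// -[e^-1]powR_inv1// -powRrM mulN1r powRN.
Qed.

Section young.
Context {R : realType}.
Variables (a b p : R).
Hypotheses (a0 : 0 < a) (b0 : 0 < b) (abp : a + b = p).

(** With [M = x^a y^b] and [z = ln x - ln y] one has [x^p = M expR (b z)] and
    [y^p = M expR (- a z)]; the linear terms [a b z] and [- b a z] cancel, and
    Young's inequality becomes two instances of [1 + z <= expR z]. *)
Let powR_split (x y : R) : 0 < x -> 0 < y ->
  a * x `^ p + b * y `^ p - p * (x `^ a * y `^ b) =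
  x `^ a * y `^ b *
    (a * (expR (b * (ln x - ln y)) - (1 + b * (ln x - ln y))) +
     b * (expR (a * (ln y - ln x)) - (1 + a * (ln y - ln x)))).
Proof.
move=> x0 y0; rewrite /powR !gt_eqF// -expRD.
rewrite (_ : p * ln x = (a * ln x + b * ln y) + b * (ln x - ln y)); last first.
  by rewrite -abp; ring.
rewrite (_ : p * ln y = (a * ln x + b * ln y) + a * (ln y - ln x)); last first.
  by rewrite -abp; ring.
by rewrite ![expR (a * ln x + b * ln y + _)]expRD -abp; ring.
Qed.

Lemma young_powR (x y : R) : 0 <= x -> 0 <= y ->
  p * (x `^ a * y `^ b) <= a * x `^ p + b * y `^ p.
Proof.
have h z w : 0 <= a * z `^ p + b * w `^ p by rewrite addr_ge0// mulr_ge0 ?powR_ge0// ltW.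
rewrite le_eqVlt => /predU1P[<- _|x0]; first by rewrite powR0 ?gt_eqF// mul0r mulr0.
rewrite le_eqVlt => /predU1P[<-|y0]; first by rewrite (@powR0 _ b) ?gt_eqF// !mulr0.
rewrite -subr_ge0 powR_split// mulr_ge0 ?mulr_ge0 ?powR_ge0//.
by rewrite addr_ge0// mulr_ge0 ?subr_ge0 ?expR_ge1Dx// ltW.
Qed.

(** Equality in Young's inequality forces equality in [1 + z <= expR z]. *)
Lemma young_powR_eq (x y : R) : 0 < x -> 0 < y ->
  p * (x `^ a * y `^ b) = a * x `^ p + b * y `^ p -> x = y.
Proof.
move=> x0 y0 E; apply: ln_inj; rewrite ?posrE//.
apply/eqP; rewrite -subr_eq0; apply/negPn/negP => d0.
have : a * x `^ p + b * y `^ p - p * (x `^ a * y `^ b) = 0 by rewrite E subrr.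
rewrite powR_split//; apply/eqP; rewrite gt_eqF// mulr_gt0//.
  by rewrite mulr_gt0 ?powR_gt0.
apply: ltr_pwDl; first by rewrite mulr_gt0// subr_gt0 expR_gt1Dx// mulf_neq0// gt_eqF.
by rewrite mulr_ge0 ?subr_ge0 ?expR_ge1Dx// ltW.
Qed.

End young.

(** * Hardy-Sobolev integrals and Hoelder's inequality *)

Section hardy_sobolev_D012.
Context {R : realType} {N : nat}.
Variables (Om : set 'rV[R]_N) (s : R).
Hypotheses (N3 : (3 <= N)%N) (oOm : open Om) (s0 : 0 < s) (s2 : s < 2).
Implicit Types (u v : fgrad R N) (x : 'rV[R]_N).

Let mOm : measurable Om. Proof. exact: open_measurable_rV. Qed.

Local Notation q := (@critical_sobolev R N).
Local Notation p := (@hsexp R N s).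
Local Notation integrable f := ((leb N).-integrable Om (EFin \o f)).

Lemma hsexp_gt2 : 2 < p.
Proof. rewrite /hsexp ltr_pdivlMr ?N2_gt0//. by rewrite ltr_pM2l// ltrD2l ltrN2. Qed.

Let p_gt0 : 0 < p. Proof. exact: lt_trans hsexp_gt2. Qed.

Lemma enorm_ge0 x : 0 <= enorm x. Proof. exact: sqrtr_ge0. Qed.

Lemma enorm_eq0 x : enorm x = 0 -> x = 0.
Proof.
by move=> x0; apply: dotv_eq0; rewrite -enorm_sqr x0 expr0n.
Qed.

Lemma enorm_gt0 x : x != 0 -> 0 < enorm x.
Proof.
move=> x0; rewrite lt_neqAle enorm_ge0 andbT eq_sym.
by apply: contra x0 => /eqP/enorm_eq0 ->.
Qed.

Lemma weight_gt0 x : x != 0 -> 0 < enorm x `^ s.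
Proof. by move=> x0; rewrite powR_gt0 ?enorm_gt0. Qed.

Lemma measurable_weight (D : set 'rV[R]_N) (f : 'rV[R]_N -> R) : measurable_fun D f ->
  measurable_fun D (fun x => f x / enorm x `^ s).
Proof.
move=> mf; apply: measurable_funM => //.
rewrite (_ : (fun x => _) = (fun x => dotv x x `^ (2^-1 * - s))).
  apply: (measurableT_comp (measurable_powR _)).
  have := continuous_measurable_rV (@continuous_dotv R N); exact: measurable_funS.
by apply/funext => x; rewrite powRrM powR12_sqrt ?dotv_ge0// powRN.
Qed.

(** [u^p/|x|^s] is the geometric mean of [u^2/|x|^2] and [u^q] with weights
    [s/2] and [1-s/2]. *)
Lemma hs_interpolation (r t : R) : 0 <= r -> 0 <= t ->
  t `^ p / r `^ s <= t ^+ 2 / r ^+ 2 + t `^ q.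
Proof.
move=> r0 t0.
have X0 e : 0 <= t ^+ 2 / e ^+ 2 + t `^ q by rewrite addr_ge0 ?divr_ge0 ?sqr_ge0 ?powR_ge0.
have [->|rn0] := eqVneq r 0; first by rewrite (@powR0 _ s) ?gt_eqF// invr0 mulr0.
have [tE|tn0] := eqVneq t 0; first by rewrite {1}tE (@powR0 _ p) ?gt_eqF// mul0r.
have {}r0 : 0 < r by rewrite lt_neqAle eq_sym rn0.
have {}t0 : 0 < t by rewrite lt_neqAle eq_sym tn0.
set X := t ^+ 2 / r ^+ 2; set Y := t `^ q.
have -> : t `^ p / r `^ s = X `^ (s / 2) * Y `^ (1 - s / 2).
  rewrite (_ : X `^ (s / 2) = t `^ s / r `^ s); last first.
    rewrite /X -expr_div_n -powR_mulrn ?divr_ge0 ?ltW// -powRrM.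
    rewrite (_ : 2%:R * (s / 2) = s); last by field.
    by rewrite powR_div// ltW.
  rewrite mulrAC /Y -powRrM -powRD; last by rewrite (gt_eqF t0) implybT.
  congr (_ `^ _ / _); rewrite /hsexp /critical_sobolev; field.
  by rewrite gt_eqF// N2_gt0.
have XX0 : 0 <= X by rewrite divr_ge0 ?sqr_ge0.
have YY0 : 0 <= Y by exact: powR_ge0.
have h e : 0 <= e -> X `^ e <= (X + Y) `^ e /\ Y `^ e <= (X + Y) `^ e.
  move=> e0; split; apply: ge0_ler_powR; rewrite ?nnegrE ?addr_ge0//.
    by rewrite lerDl.
  by rewrite lerDr.
have XY0 : 0 < X + Y by rewrite ltr_wpDl// powR_gt0.
have s20 : 0 <= s / 2 by rewrite divr_ge0// ltW.
have s21 : 0 <= 1 - s / 2 by move: s2; lra.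
have -> : X + Y = (X + Y) `^ (s / 2) * (X + Y) `^ (1 - s / 2).
  rewrite -powRD; last by rewrite (gt_eqF XY0) implybT.
  by rewrite [s / 2 + _]addrC subrK powRr1// ltW.
by apply: ler_pM; rewrite ?powR_ge0//; [have [] := h _ s20|have [] := h _ s21].
Qed.

Lemma hs_integrable u : D012 Om u ->
  integrable (fun x => `|u.1 x| `^ p / enorm x `^ s).
Proof.
move=> Du; have [mu1 _ _] := (D012P oOm u).1 Du.
have [iq _] := D012_integrable N3 oOm Du; have [ih _] := hardy N3 oOm Du.
apply: (le_ge0_integrable mOm _ _ (integrable_add mOm ih iq)) => [|x _].
  by apply: measurable_weight; exact: measurable_normpow.
rewrite divr_ge0 ?powR_ge0//= -enorm_sqr.
have := hs_interpolation (enorm_ge0 x) (normr_ge0 (u.1 x)).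
by rewrite real_normK ?num_real.
Qed.

Lemma ae_neq0 : {ae leb N, forall x, x != 0}.
Proof.
case: N N3 => // n _; exists [set 0]; split.
- rewrite (_ : [set 0] = [set x : 'rV[R]_n.+1 | `|x| <= 0]).
    exact: measurable_norm_le.
  by apply/seteqP; split => x /=; rewrite normr_le0 => /eqP.
- exact: leb_point0.
- by move=> x /= /negP/negPn/eqP.
Qed.

(** Hardy's inequality bounds the integral of [u^2 / |x|^2] by zero. *)
Lemma dirichlet_eq0 u : D012 Om u -> dirichlet Om u = 0 -> null_on Om u.
Proof.
move=> Du Du0; have [ih lh] := hardy N3 oOm Du.
rewrite Du0 mulr0 in lh.
have f0 x : 0 <= u.1 x ^+ 2 / dotv x x by rewrite divr_ge0 ?sqr_ge0 ?dotv_ge0.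
have I0 : \int[leb N]_(x in Om) (u.1 x ^+ 2 / dotv x x) = 0.
  by apply/eqP; rewrite eq_le lh/= Rintegral_ge0.
have := Rintegral0_ae mOm ih (fun x _ => f0 x) I0.
apply: filterS2 ae_neq0 => x x0 h Omx; have /eqP := h Omx.
rewrite mulf_eq0 invr_eq0 -enorm_sqr !expf_eq0/= (gt_eqF (enorm_gt0 x0)) orbF.
by move/eqP.
Qed.

Lemma hs_int_eq0 u : D012 Om u -> hs_int Om s u = 0 -> null_on Om u.
Proof.
move=> Du Iu; have ih := hs_integrable Du.
have f0 x : 0 <= `|u.1 x| `^ p / enorm x `^ s by rewrite divr_ge0 ?powR_ge0.
have := Rintegral0_ae mOm ih (fun x _ => f0 x) Iu.
apply: filterS2 ae_neq0 => x x0 h Omx; have /eqP := h Omx.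
rewrite mulf_eq0 invr_eq0 (gt_eqF (weight_gt0 x0)) orbF powR_eq0 normr_eq0.
by case/andP => /eqP.
Qed.

Lemma hs_int_ge0 u : 0 <= hs_int Om s u.
Proof. by apply: Rintegral_ge0 => x _; rewrite divr_ge0 ?powR_ge0. Qed.

Lemma hs_int_gt0 u : D012 Om u -> ~ null_on Om u -> 0 < hs_int Om s u.
Proof.
move=> Du nu; rewrite lt_neqAle hs_int_ge0 andbT eq_sym.
by apply/eqP => /(hs_int_eq0 Du).
Qed.

Lemma dirichlet_ge0 u : 0 <= dirichlet Om u.
Proof. by apply: Rintegral_ge0 => x _; rewrite sqr_ge0. Qed.

Lemma dirichlet_gt0 u : D012 Om u -> ~ null_on Om u -> 0 < dirichlet Om u.
Proof.
move=> Du nu; rewrite lt_neqAle dirichlet_ge0 andbT eq_sym.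
by apply/eqP => /(dirichlet_eq0 Du).
Qed.

Section mixed.
Variables (a b : R).
Hypotheses (a0 : 0 < a) (b0 : 0 < b) (abp : a + b = p).

Definition mixed_int u v : R :=
  \int[leb N]_(x in Om) (`|u.1 x| `^ a * `|v.1 x| `^ b / enorm x `^ s).

Lemma mixed_integrable u v : D012 Om u -> D012 Om v ->
  integrable (fun x => `|u.1 x| `^ a * `|v.1 x| `^ b / enorm x `^ s).
Proof.
move=> Du Dv; have [mu1 _ _] := (D012P oOm u).1 Du; have [mv1 _ _] := (D012P oOm v).1 Dv.
apply: (le_ge0_integrable mOm _ _ (integrable_lin mOm (a / p) (b / p)
  (hs_integrable Du) (hs_integrable Dv))) => [|x _].
  by apply: measurable_weight; apply: measurable_funM; exact: measurable_normpow.
rewrite divr_ge0 ?mulr_ge0 ?powR_ge0//=.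
rewrite 2!mulrA -mulrDl ler_wpM2r ?invr_ge0 ?powR_ge0//.
rewrite -(ler_pM2l p_gt0); apply: le_trans (young_powR a0 b0 abp _ _) _ => //.
by apply: le_of_eq; field; exact: lt0r_neq0.
Qed.

(** Hoelder's inequality, as the integral of Young's inequality for the
    normalised functions [u/c] and [v/d]; this form keeps the equality case. *)
Lemma mixed_holder u v (c d : R) : D012 Om u -> D012 Om v -> 0 < c -> 0 < d ->
  hs_int Om s u = c `^ p -> hs_int Om s v = d `^ p ->
  mixed_int u v <= c `^ a * d `^ b /\
  (mixed_int u v = c `^ a * d `^ b ->
   {ae leb N, forall x, Om x -> 0 < `|u.1 x| -> 0 < `|v.1 x| ->
      d * `|u.1 x| = c * `|v.1 x|}).
Proof.
move=> Du Dv c0 d0 Iu Iv.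
have iu := hs_integrable Du; have iv := hs_integrable Dv.
have im := mixed_integrable Du Dv.
set k := c `^ a * d `^ b; have k0 : 0 < k by rewrite mulr_gt0 ?powR_gt0.
pose A := k * (a / p) / c `^ p; pose B := k * (b / p) / d `^ p.
pose F x := A * (`|u.1 x| `^ p / enorm x `^ s) + B * (`|v.1 x| `^ p / enorm x `^ s).
pose G x := `|u.1 x| `^ a * `|v.1 x| `^ b / enorm x `^ s.
have IF : \int[leb N]_(x in Om) F x = k.
  rewrite Rintegral_lin// -/(hs_int Om s u) -/(hs_int Om s v) Iu Iv /A /B -abp.
  by field; rewrite !gt_eqF ?powR_gt0// abp.
have iF : integrable F by exact: integrable_lin.
have E x : F x - G x = k / p / enorm x `^ s *
    (a * (`|u.1 x| / c) `^ p + b * (`|v.1 x| / d) `^ p -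
      p * ((`|u.1 x| / c) `^ a * (`|v.1 x| / d) `^ b)).
  rewrite /F /G /A /B !powR_div//.
  have [->|w0] := eqVneq (enorm x `^ s) 0.
    by rewrite invr0 !mulr0 mul0r addr0 subrr.
  by rewrite /k; field; rewrite w0 !gt_eqF ?powR_gt0.
have FG x : 0 <= F x - G x.
  rewrite E; apply: mulr_ge0; last rewrite subr_ge0.
    by apply: divr_ge0; [apply: divr_ge0; exact: ltW|exact: powR_ge0].
  by apply: young_powR => //; rewrite divr_ge0// ltW.
have GF x : G x <= F x by rewrite -subr_ge0.
split; first by rewrite -IF; exact: (le_Rintegral mOm im iF (fun x _ => GF x)).
move=> EG.
have iFG : integrable (fun x => F x - G x) by exact: (integrableB mOm iF im).
have : \int[leb N]_(x in Om) (F x - G x) = 0.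
  by rewrite RintegralB// IF -/(mixed_int u v) EG subrr.
move/(Rintegral0_ae mOm iFG (fun x _ => FG x)).
apply: filterS2 ae_neq0 => x x0 h Omx ux vx; have /eqP := h Omx.
rewrite E mulf_eq0 gt_eqF/=; last first.
  by apply: divr_gt0; [exact: divr_gt0|exact: weight_gt0].
rewrite subr_eq0 eq_sym => /eqP/young_powR_eq => /(_ a0 b0 abp) e.
have : `|u.1 x| / c = `|v.1 x| / d by apply: e; rewrite divr_gt0.
move/eqP; rewrite eqr_div ?(gt_eqF c0) ?(gt_eqF d0)// => /eqP; rewrite mulrC => ->.
by rewrite mulrC.
Qed.

End mixed.
End hardy_sobolev_D012.

(** * The energy on the Nehari set *)

Section functionals.
Context {R : realType} {N : nat}.
Variables (Om : set 'rV[R]_N) (s : R).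
Hypotheses (N3 : (3 <= N)%N) (oOm : open Om) (s0 : 0 < s) (s2 : s < 2).
Implicit Types (u v : fgrad R N) (x : 'rV[R]_N).

Let mOm : measurable Om. Proof. exact: open_measurable_rV. Qed.

Local Notation p := (@hsexp R N s).
Local Notation integrable f := ((leb N).-integrable Om (EFin \o f)).

Let p_gt2 : 2 < p. Proof. exact: hsexp_gt2. Qed.
Let p_gt0 : 0 < p. Proof. exact: lt_trans p_gt2. Qed.

Lemma dirichlet_integrable u : D012 Om u -> integrable (fun x => enorm (u.2 x) ^+ 2).
Proof. by move=> Du; have [] := D012_integrable N3 oOm Du. Qed.

Lemma dotv_integrable u v : D012 Om u -> D012 Om v ->
  integrable (fun x => dotv (u.2 x) (v.2 x)).
Proof.
move=> Du Dv; have [_ mu _] := (D012P oOm u).1 Du; have [_ mv _] := (D012P oOm v).1 Dv.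
apply: le_integrable (integrable_add mOm (dirichlet_integrable Du) (dirichlet_integrable Dv)) => //.
  by apply/measurable_EFinP; exact: measurable_dotv.
move=> x _; rewrite /= lee_fin [leRHS]ger0_norm ?addr_ge0 ?sqr_ge0// !enorm_sqr.
rewrite /dotv -big_split/= (le_trans (ler_norm_sum _ _ _))//; apply: ler_sum => i _.
set y := u.2 x ord0 i; set z := v.2 x ord0 i.
have := sqr_ge0 (y - z); have := sqr_ge0 (y + z).
by rewrite ler_norml => *; apply/andP; split; nra.
Qed.

Lemma dirichlet_add u v (t : R) : D012 Om u -> D012 Om v ->
  dirichlet Om (u + t *: v) = dirichlet Om u +
    2 * t * (\int[leb N]_(x in Om) dotv (u.2 x) (v.2 x)) + t ^+ 2 * dirichlet Om v.
Proof.
move=> Du Dv; have iu := dirichlet_integrable Du; have iv := dirichlet_integrable Dv.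
have id := dotv_integrable Du Dv.
transitivity (\int[leb N]_(x in Om) ((enorm (u.2 x) ^+ 2 +
    2 * t * dotv (u.2 x) (v.2 x)) + t ^+ 2 * enorm (v.2 x) ^+ 2)).
  apply: eq_Rintegral => x _; rewrite !enorm_sqr /dotv !mulr_sumr -!big_split/=.
  by apply: eq_bigr => i _; rewrite !mxE; ring.
have i1 := integrableZ mOm (2 * t) id; have i2 := integrableZ mOm (t ^+ 2) iv.
have i3 := integrable_add mOm iu i1.
by rewrite RintegralD// RintegralD// !RintegralZl.
Qed.

Lemma dirichletZ u (c : R) : D012 Om u -> dirichlet Om (c *: u) = c ^+ 2 * dirichlet Om u.
Proof.
move=> Du; rewrite /dirichlet -RintegralZl//; last exact: dirichlet_integrable.
by apply: eq_Rintegral => x _; rewrite !enorm_sqr -dotvZ.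
Qed.

Lemma hs_intZ u (c : R) : D012 Om u ->
  hs_int Om s (c *: u) = `|c| `^ p * hs_int Om s u.
Proof.
move=> Du; rewrite /hs_int -RintegralZl//; last exact: hs_integrable.
apply: eq_Rintegral => x _; rewrite mulrA -powRM//.
by rewrite -normrM.
Qed.

Lemma null_onZ u (c : R) : c != 0 -> null_on Om (c *: u) -> null_on Om u.
Proof.
move=> c0; apply: filterS => x h Omx; have /eqP := h Omx.
by rewrite -[(c *: u).1 x]/(c * u.1 x) mulf_eq0 (negPf c0) => /eqP.
Qed.

Variables (lambda mu kappa alpha beta : R).
Hypotheses (l0 : 0 < lambda) (mu0 : 0 < mu) (k0 : 0 < kappa).
Hypotheses (a1 : 1 < alpha) (b1 : 1 < beta) (abp : alpha + beta = p).

Let a0 : 0 < alpha. Proof. exact: lt_trans a1. Qed.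
Let b0 : 0 < beta. Proof. exact: lt_trans b1. Qed.

Local Notation sysint := (system_int Om s lambda mu kappa alpha beta).
Local Notation mixed := (mixed_int Om s alpha beta).
Local Notation Phi := (Phi Om s lambda mu kappa alpha beta).

Lemma system_intE u v : D012 Om u -> D012 Om v ->
  sysint u v = lambda * hs_int Om s u + mu * hs_int Om s v + p * kappa * mixed u v.
Proof.
move=> Du Dv.
have iu := integrableZ mOm lambda (hs_integrable N3 oOm s0 s2 Du).
have iv := integrableZ mOm mu (hs_integrable N3 oOm s0 s2 Dv).
have im := mixed_integrable N3 oOm s0 s2 a0 b0 abp Du Dv.
rewrite /system_int RintegralD//; first last.
- exact: integrableZ.
- exact: integrable_add.
rewrite RintegralD// !RintegralZl//; exact: hs_integrable.
Qed.

Lemma mixed_intZ u v (c d : R) : D012 Om u -> D012 Om v ->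
  mixed (c *: u) (d *: v) = `|c| `^ alpha * `|d| `^ beta * mixed u v.
Proof.
move=> Du Dv; rewrite /mixed_int -RintegralZl//; last exact: mixed_integrable.
apply: eq_Rintegral => x _.
rewrite -[(c *: u).1 x]/(c * u.1 x) -[(d *: v).1 x]/(d * v.1 x).
by rewrite !normrM !powRM//; ring.
Qed.

Lemma mixed_int_ge0 u v : 0 <= mixed u v.
Proof. by apply: Rintegral_ge0 => x _; rewrite divr_ge0 ?mulr_ge0 ?powR_ge0. Qed.

Lemma system_intZ u v (c : R) : 0 < c -> D012 Om u -> D012 Om v ->
  sysint (c *: u) (c *: v) = c `^ p * sysint u v.
Proof.
move=> c0 Du Dv; have Dcu := D012Z N3 oOm c Du; have Dcv := D012Z N3 oOm c Dv.
rewrite (system_intE Dcu Dcv) (system_intE Du Dv).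
rewrite (hs_intZ _ Du) (hs_intZ _ Dv) (mixed_intZ _ _ Du Dv) (gtr0_norm c0).
rewrite -powRD; last by rewrite (gt_eqF c0) implybT.
rewrite abp; move: (hs_int Om s u) (hs_int Om s v) (mixed u v) => A B M; ring.
Qed.

Lemma system_int_gt0 u v : D012_pair Om (u, v) -> 0 < sysint u v.
Proof.
move=> [/= Du Dv nuv]; rewrite (system_intE Du Dv).
have hu := mulr_ge0 (ltW l0) (hs_int_ge0 Om s u).
have hv := mulr_ge0 (ltW mu0) (hs_int_ge0 Om s v).
have m0 := mulr_ge0 (mulr_ge0 (ltW p_gt0) (ltW k0)) (mixed_int_ge0 u v).
apply: (ltr_pwDl _ m0); have [nu|nu] := pselect (null_on Om u).
  have nv : ~ null_on Om v by move=> nv; exact: (nuv (conj nu nv)).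
  exact: (ltr_wpDl hu (mulr_gt0 mu0 (hs_int_gt0 N3 oOm s0 s2 Dv nv))).
exact: (ltr_pwDl (mulr_gt0 l0 (hs_int_gt0 N3 oOm s0 s2 Du nu)) hv).
Qed.

Lemma dirichlet_pair_gt0 u v : D012_pair Om (u, v) ->
  0 < dirichlet Om u + dirichlet Om v.
Proof.
move=> [/= Du Dv nuv]; have [nu|nu] := pselect (null_on Om u).
  have nv : ~ null_on Om v by move=> nv; exact: nuv.
  by apply: ltr_wpDl; [exact: dirichlet_ge0|exact: dirichlet_gt0].
by apply: ltr_pwDl; [exact: dirichlet_gt0|exact: dirichlet_ge0].
Qed.

(** Along the ray the energy is [(1 + t)^2 E / 2 - (1 + t)^p B / p]. *)
Lemma dPhi_ray u v : D012 Om u -> D012 Om v ->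
  dPhi Om s lambda mu kappa alpha beta u v u v
    (dirichlet Om u + dirichlet Om v - sysint u v).
Proof.
move=> Du Dv; rewrite /dPhi.
set E := dirichlet Om u + dirichlet Om v; set B := sysint u v.
have dX : is_derive (0 : R) (1 : R) (fun t : R => 1 + t) 1.
  rewrite (_ : (fun t => _) = shift 1); first exact: is_derive_shift.
  by apply/funext => t; rewrite /= addrC.
have dP : is_derive (0 : R) (1 : R) (fun t : R => (1 + t) `^ p) p.
  have d1 : is_derive (1 + 0 : R) (1 : R) (@powR R ^~ p) p.
    by have := @is_derive1_powR _ p 1 ltr01; rewrite powR1 mulr1 addr0.
  by apply: is_derive_eq (is_derive1_comp d1 dX) _; rewrite mulr1.
have H : is_derive (0 : R) (1 : R)
    (fun t : R => 1 / 2 * E * (1 + t) ^+ 2 - 1 / p * B * (1 + t) `^ p) (E - B).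
  have d2 := is_deriveZ (1 / 2 * E) (is_deriveX 2 dX).
  have d3 := is_deriveZ (1 / p * B) dP.
  apply: is_derive_eq (is_deriveB d2 d3) _.
  rewrite -![_ *: _]/(_ * _) /= addr0 expr1; field; exact: lt0r_neq0.
apply: near_eq_is_derive H; near=> t.
have t1 : 0 < 1 + t.
  rewrite -ltrBlDl sub0r; near: t; apply: lt_nbhsr; exact: ltrN10.
have uE w : w + t *: w = (1 + t) *: w by rewrite scalerDl scale1r.
rewrite !uE /Phi (dirichletZ _ Du) (dirichletZ _ Dv) (system_intZ t1 Du Dv) -/B -mulrDr -/E; ring.
Unshelve. all: by end_near. Qed.

Lemma dPhi_ray_unique u v l : D012 Om u -> D012 Om v ->
  dPhi Om s lambda mu kappa alpha beta u v u v l ->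
  l = dirichlet Om u + dirichlet Om v - sysint u v.
Proof. by move=> Du Dv [_ <-]; have [_ ->] := dPhi_ray Du Dv. Qed.

Lemma nehariP u v : nehari Om s lambda mu kappa alpha beta (u, v) <->
  D012_pair Om (u, v) /\ dirichlet Om u + dirichlet Om v = sysint u v.
Proof.
split=> -[pw H]; have [Du Dv _] := pw; split; first exact: pw.
- by apply/eqP; rewrite -subr_eq0; apply/eqP; rewrite -(dPhi_ray_unique Du Dv H).
- exact: pw.
- by have := dPhi_ray Du Dv; rewrite H subrr.
Qed.

Lemma Phi_nehari u v : dirichlet Om u + dirichlet Om v = sysint u v ->
  Phi u v = (1 / 2 - 1 / p) * (dirichlet Om u + dirichlet Om v).
Proof. by move=> E; rewrite /Defs.Phi -E; ring. Qed.

Definition system_quotient u v : R :=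
  (dirichlet Om u + dirichlet Om v) / sysint u v `^ (2 / p).

Lemma system_quotient_ge0 u v : 0 <= system_quotient u v.
Proof. by rewrite divr_ge0 ?powR_ge0// addr_ge0// dirichlet_ge0. Qed.

(** The factor [t] with [t^(p-2) = E / B] puts [(t u, t v)] on the Nehari set,
    where the energy is a multiple of [t^2 E = Q^(p/(p-2))]. *)
Lemma nehari_rescale u v : D012_pair Om (u, v) ->
  exists w : fgrad R N * fgrad R N,
    nehari Om s lambda mu kappa alpha beta w /\
    Phi w.1 w.2 = (1 / 2 - 1 / p) * system_quotient u v `^ (p / (p - 2)).
Proof.
move=> pw; have [/= Du Dv nuv] := pw.
have B0 := system_int_gt0 pw; have E0 := dirichlet_pair_gt0 pw.
set E := dirichlet Om u + dirichlet Om v in E0 *; set B := sysint u v in B0 *.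
have p20 : 0 < p - 2 by rewrite subr_gt0.
pose t := (E / B) `^ (p - 2)^-1.
have t0 : 0 < t by rewrite powR_gt0// divr_gt0.
have tE : t ^+ 2 * E = t `^ p * B.
  rewrite (_ : t `^ p = t ^+ 2 * t `^ (p - 2)); last first.
    rewrite -powR_mulrn ?ltW// -powRD ?(gt_eqF t0) ?implybT//.
    by congr (_ `^ _); rewrite addrC subrK.
  rewrite /t -[in X in _ = _ * X * _]powRrM mulVf ?gt_eqF// powRr1 ?divr_ge0 ?ltW//.
  by field; exact: lt0r_neq0.
have Eq : dirichlet Om (t *: u) + dirichlet Om (t *: v) = sysint (t *: u) (t *: v).
  by rewrite (dirichletZ _ Du) (dirichletZ _ Dv) (system_intZ t0 Du Dv) -mulrDr.
exists (t *: u, t *: v); split.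
  apply/nehariP; split; last exact: Eq.
  split => /=; [exact: (D012Z N3 oOm t Du)|exact: (D012Z N3 oOm t Dv)|].
  have tn0 : t != 0 by exact: lt0r_neq0.
  by move=> [nu nv]; apply: nuv; split; [exact: (null_onZ tn0 nu)|exact: (null_onZ tn0 nv)].
rewrite /= (Phi_nehari Eq) (dirichletZ _ Du) (dirichletZ _ Dv) -mulrDr -/E; congr (_ * _).
rewrite /system_quotient -/E -/B powR_div ?powR_gt0 ?ltW// -powRrM.
rewrite (_ : 2 / p * (p / (p - 2)) = 2 / (p - 2)); last first.
  by field; rewrite !gt_eqF.
rewrite (_ : p / (p - 2) = 1 + 2 / (p - 2)); last by field; exact: lt0r_neq0.
rewrite powRD ?(gt_eqF E0) ?implybT// powRr1 ?ltW//.
rewrite /t -powR_mulrn ?powR_ge0// -powRrM powR_div ?ltW//.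
by rewrite (_ : (p - 2)^-1 * 2%:R = 2 / (p - 2)) ?mulrA; [rewrite mulrC mulrA|rewrite mulrC].
Qed.

Variables (phi psi : fgrad R N).
Hypothesis gs : system_ground_state Om s lambda mu kappa alpha beta phi psi.

Lemma ground_state_pair : D012_pair Om (phi, psi).
Proof. by case: gs => -[Du Dv _] nuv _; split; [exact: Du|exact: Dv|exact: nuv]. Qed.

Lemma ground_state_nehari : dirichlet Om phi + dirichlet Om psi = sysint phi psi.
Proof.
have [[Du Dv H] _ _] := gs; have := dPhi_ray_unique Du Dv (H _ _ Du Dv).
by move/eqP; rewrite eq_sym subr_eq0 => /eqP.
Qed.

Lemma ground_state_quotient_min u v : D012_pair Om (u, v) ->
  system_quotient phi psi <= system_quotient u v.
Proof.
have c0 : 0 < 1 / 2 - 1 / p :> R by rewrite subr_gt0 !div1r ltf_pV2 ?posrE.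
have p20 : 0 < p - 2 by rewrite subr_gt0.
move=> pw; have [w [nw Pw]] := nehari_rescale pw.
have E0 := dirichlet_pair_gt0 ground_state_pair.
have le : Phi phi psi <= Phi w.1 w.2.
  have [_ _ ->] := gs; apply: ge_inf; last by exists w.
  exists 0 => _ [[u' v'] /nehariP[pw' E'] <-] /=.
  rewrite (Phi_nehari E'); apply: mulr_ge0; first exact: ltW.
  by apply: addr_ge0; exact: dirichlet_ge0.
rewrite Pw in le; rewrite (Phi_nehari ground_state_nehari) in le.
move: le; rewrite (ler_pM2l c0) => le.
have -> : system_quotient phi psi = (dirichlet Om phi + dirichlet Om psi) `^ ((p - 2) / p).
  rewrite /system_quotient -ground_state_nehari.
  rewrite (_ : (p - 2) / p = 1 + - (2 / p)); last by field; exact: lt0r_neq0.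
  by rewrite powRD ?(gt_eqF E0) ?implybT// powRr1 ?ltW// powRN.
have -> : system_quotient u v = (system_quotient u v `^ (p / (p - 2))) `^ ((p - 2) / p).
  rewrite -powRrM (_ : _ * _ = 1) ?powRr1 ?system_quotient_ge0//.
  by field; rewrite !gt_eqF.
apply: (ge0_ler_powR (divr_ge0 (ltW p20) (ltW p_gt0)) _ _ le); rewrite nnegrE.
  exact: ltW.
exact: powR_ge0.
Qed.

Lemma S_constE : S_const Om s lambda mu kappa alpha beta = system_quotient phi psi.
Proof.
rewrite /S_const; apply/eqP; rewrite eq_le; apply/andP; split.
  apply: ge_inf; last by exists (phi, psi) => //; exact: ground_state_pair.
  by exists 0 => _ [w _ <-]; exact: system_quotient_ge0.
apply: lb_le_inf.
  by exists (system_quotient phi psi), (phi, psi) => //; exact: ground_state_pair.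
by move=> _ [[u v] pw <-]; exact: ground_state_quotient_min.
Qed.

End functionals.

(** * The scalar problem *)

Lemma inf_eq_min (R : realType) (A : set R) (m : R) : A m -> lbound A m -> inf A = m.
Proof.
move=> Am mA; apply/eqP; rewrite eq_le; apply/andP; split.
  by apply: ge_inf => //; exists m.
by apply: lb_le_inf => //; exists m.
Qed.

Lemma linear_term_eq0 (R : realType) (x y : R) :
  (forall t, 0 <= 2 * t * x + t ^+ 2 * y) -> x = 0.
Proof.
move=> h; apply/eqP/negPn/negP => x0.
have y0 : 0 < `|y| + 1 by rewrite ltr_wpDl.
have := h (- x / (`|y| + 1)).
have -> : 2 * (- x / (`|y| + 1)) * x + (- x / (`|y| + 1)) ^+ 2 * y =
    x ^+ 2 / (`|y| + 1) ^+ 2 * (y - 2 * (`|y| + 1)).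
  by field; rewrite gt_eqF.
rewrite pmulr_rge0; last first.
  by apply: divr_gt0; [rewrite exprn_even_gt0|exact: exprn_gt0].
by have := ler_norm y; lra.
Qed.

Section scalar_problem.
Context {R : realType} {N : nat}.
Variables (Om : set 'rV[R]_N) (s : R).
Hypotheses (N3 : (3 <= N)%N) (oOm : open Om) (s0 : 0 < s) (s2 : s < 2).
Implicit Types (u v w h : fgrad R N) (x : 'rV[R]_N).

Let mOm : measurable Om. Proof. exact: open_measurable_rV. Qed.

Local Notation p := (@hsexp R N s).
Local Notation integrable f := ((leb N).-integrable Om (EFin \o f)).

Let p_gt2 : 2 < p. Proof. exact: hsexp_gt2. Qed.
Let p_gt0 : 0 < p. Proof. exact: lt_trans p_gt2. Qed.

Lemma Rintegral_ae (f g : 'rV[R]_N -> R) : measurable_fun Om f -> measurable_fun Om g ->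
  {ae leb N, forall x, Om x -> f x = g x} ->
  \int[leb N]_(x in Om) f x = \int[leb N]_(x in Om) g x.
Proof.
move=> mf mg fg; congr fine; apply: ae_eq_integral => //.
- exact/measurable_EFinP.
- exact/measurable_EFinP.
- by apply: filterS fg => x e Omx; rewrite e.
Qed.

Lemma null_hs_int u : D012 Om u -> null_on Om u -> hs_int Om s u = 0.
Proof.
move=> Du nu; have [mu1 _ _] := (D012P oOm u).1 Du.
rewrite /hs_int (@Rintegral_ae _ (cst 0)); first by rewrite /Rintegral integral0.
- by apply: measurable_weight; exact: measurable_normpow.
- exact: measurable_cst.
- by apply: filterS nu => x e Omx; rewrite e// normr0 powR0 ?mul0r// gt_eqF.
Qed.

Variables (U : fgrad R N) (m : R).
Hypotheses (DU : D012 Om U) (U0 : positive_on Om U) (hU : hs_int Om s U = 1)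
  (dU : dirichlet Om U = m) (m0 : 0 < m)
  (Umin : forall u, D012 Om u -> ~ null_on Om u ->
     m * hs_int Om s u `^ (2 / p) <= dirichlet Om u).

Lemma mu_s_min : mu_s Om s = m.
Proof.
apply: inf_eq_min; first by exists U.
move=> _ [u [Du hu] <-].
have nu : ~ null_on Om u.
  by move=> /(null_hs_int Du)/eqP; rewrite hu oner_eq0.
by have := Umin Du nu; rewrite hu powR1 mulr1.
Qed.

(** Up to the factor [p], the derivative at [U] of the constraint
    [int |w|^p / |x|^s = 1].  The absolute value makes Hoelder's inequality
    applicable; it disappears almost everywhere since [U] is positive. *)
Let J w := \int[leb N]_(x in Om) (`|U.1 x| `^ (p - 1) * w.1 x / enorm x `^ s).

Let p1_gt0 : 0 < p - 1. Proof. by rewrite subr_gt0 (lt_trans _ p_gt2)// ltr1n. Qed.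
Let p1E : p - 1 + 1 = p. Proof. by rewrite subrK. Qed.

Let mixed1E w x :
  Num.norm (`|U.1 x| `^ (p - 1) * w.1 x / enorm x `^ s) =
  `|U.1 x| `^ (p - 1) * `|w.1 x| `^ 1 / enorm x `^ s.
Proof. by rewrite powRr1// !normrM normfV !(ger0_norm (powR_ge0 _ _)). Qed.

Let J_integrable w : D012 Om w ->
  integrable (fun x => `|U.1 x| `^ (p - 1) * w.1 x / enorm x `^ s).
Proof.
move=> Dw; have im := mixed_integrable N3 oOm s0 s2 p1_gt0 ltr01 p1E DU Dw.
have [mU1 _ _] := (D012P oOm U).1 DU; have [mw1 _ _] := (D012P oOm w).1 Dw.
apply: le_integrable im => //.
  apply/measurable_EFinP; apply: measurable_weight; apply: measurable_funM => //.
  exact: measurable_normpow.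
by move=> x _; rewrite /= lee_fin mixed1E ler_norm.
Qed.

Let J_add w (t : R) : D012 Om w -> J (U + t *: w) = J U + t * J w.
Proof.
move=> Dw; have iU := J_integrable DU; have iw := J_integrable Dw.
have := Rintegral_lin mOm 1 t iU iw; rewrite mul1r /J => <-.
apply: eq_Rintegral => x _; rewrite -[(U + t *: w).1 x]/(U.1 x + t * w.1 x).
by rewrite mul1r mulrDr mulrDl; congr (_ + _); ring.
Qed.

(** Hoelder's inequality with exponents [p - 1] and [1] bounds [|J w|] by the
    weighted [L^p] norm of [w], and minimality bounds the latter. *)
Let J_le w : D012 Om w -> m * J w ^+ 2 <= dirichlet Om w.
Proof.
move=> Dw; have [mw1 _ _] := (D012P oOm w).1 Dw; have [mU1 _ _] := (D012P oOm U).1 DU.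
have [nw|nw] := pselect (null_on Om w).
  have -> : J w = 0.
    rewrite /J (@Rintegral_ae _ (cst 0)); first by rewrite /Rintegral integral0.
    - apply: measurable_weight; apply: measurable_funM => //; exact: measurable_normpow.
    - exact: measurable_cst.
    - by apply: filterS nw => x e Omx; rewrite e// mulr0 mul0r.
  by rewrite expr0n mulr0; exact: dirichlet_ge0.
have h0 := hs_int_gt0 N3 oOm s0 s2 Dw nw.
set c := hs_int Om s w `^ p^-1; have c0 : 0 < c by exact: powR_gt0.
have cp : hs_int Om s w = c `^ p.
  by rewrite /c -powRrM mulVf ?gt_eqF// powRr1// ltW.
have [hm _] := mixed_holder N3 oOm s0 s2 p1_gt0 ltr01 p1E DU Dw ltr01 c0
  (etrans hU (esym (congr1 (@^~ p) (powR1 R)))) cp.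
have Jc : `|J w| <= c.
  apply: le_trans (le_normr_Rintegral mOm (J_integrable Dw)) _.
  under eq_Rintegral do rewrite mixed1E.
  by apply: le_trans hm _; rewrite powR1 mul1r powRr1// ltW.
apply: le_trans (Umin Dw nw).
rewrite ler_pM2l// mulrC powRrM -/c (powR_mulrn 2 (ltW c0)).
rewrite -[leLHS]real_normK ?num_real// ler_sqr ?nnegrE//; exact: ltW.
Qed.

Let J_U : J U = 1.
Proof.
have [mU1 _ _] := (D012P oOm U).1 DU; rewrite -hU /J /hs_int; apply: Rintegral_ae.
- by apply: measurable_weight; apply: measurable_funM => //; exact: measurable_normpow.
- by apply: measurable_weight; exact: measurable_normpow.
apply: filterS U0 => x h Omx; congr (_ / _); have Ux := h Omx.
by rewrite gtr0_norm// mulrC mulr_powRB1// ltW.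
Qed.

(** Perturbing [U] in the direction [h] gives a quadratic inequality in the
    parameter that is an equality at [0], so its linear term vanishes. *)
Let euler_lagrange h : D012 Om h ->
  \int[leb N]_(x in Om) dotv (U.2 x) (h.2 x) = m * J h.
Proof.
move=> Dh; apply/eqP; rewrite -subr_eq0; apply/eqP.
apply: (@linear_term_eq0 _ _ (dirichlet Om h - m * J h ^+ 2)) => t.
have := J_le (D012_add N3 oOm t DU Dh).
rewrite (dirichlet_add N3 oOm t DU Dh) (J_add t Dh) J_U dU -subr_ge0.
move: (Rintegral _ _ _) (dirichlet Om h) (J h) => I d j.
by move=> le; apply: le_trans le _; apply: le_of_eq; ring.
Qed.

Lemma scalar_solution_min : scalar_solution Om s U.
Proof.
split; first exact: DU.
- by apply: filterS U0 => x h Omx; rewrite ltW// h.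
move=> h Dh; rewrite mu_s_min (euler_lagrange Dh); apply: (congr1 ( *%R m)).
have [mU1 _ _] := (D012P oOm U).1 DU; have [mh1 _ _] := (D012P oOm h).1 Dh.
apply: Rintegral_ae.
- by apply: measurable_weight; apply: measurable_funM => //; exact: measurable_normpow.
- apply: measurable_weight; apply: measurable_funM => //.
  exact: (measurableT_comp (measurable_powR _)).
by apply: filterS U0 => x hx Omx; rewrite gtr0_norm// hx.
Qed.

(** Testing the equation with [w] itself gives [|grad w|^2 = m A] with
    [A = int w^p / |x|^s], and minimality gives [m A^(2/p) <= m A]; since
    [2 / p < 1], this forces [1 <= A]. *)
Let solution_hs_int w : scalar_solution Om s w -> ~ null_on Om w ->
  dirichlet Om w = m * hs_int Om s w /\ 1 <= hs_int Om s w.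
Proof.
move=> [Dw w0 Hw] nw; have [mw1 _ _] := (D012P oOm w).1 Dw.
have E : dirichlet Om w = m * hs_int Om s w.
  rewrite -mu_s_min /dirichlet; under eq_Rintegral do rewrite enorm_sqr.
  rewrite Hw//; congr (_ * _); apply: Rintegral_ae.
  - apply: measurable_weight; apply: measurable_funM => //.
    exact: (measurableT_comp (measurable_powR _)).
  - by apply: measurable_weight; exact: measurable_normpow.
  apply: filterS w0 => x h Omx; congr (_ / _); have wx := h Omx.
  by rewrite ger0_norm// mulrC mulr_powRB1.
split => //; have h0 := hs_int_gt0 N3 oOm s0 s2 Dw nw.
have := Umin Dw nw; rewrite E (ler_pM2l m0) => le.
rewrite leNgt; apply/negP => h1; move: le; apply/negP; rewrite -ltNge.
move: (hs_int Om s w) h0 h1 => A A0 A1.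
rewrite -[ltLHS]powRr1 ?ltW// /powR (gt_eqF A0) ltr_expR ltr_nM2r ?ln_lt0 ?A0//.
by rewrite ltr_pdivrMr// mul1r.
Qed.

(** The energy of a solution [w] is [(1/2 - 1/p) m A], which is least at [A = 1]. *)
Lemma scalar_ground_state_min : scalar_ground_state Om s U.
Proof.
have nU : ~ null_on Om U.
  by move=> /(null_hs_int DU)/eqP; rewrite hU oner_eq0.
split; [exact: scalar_solution_min|exact: nU| |exact: hU|by rewrite dU mu_s_min].
move=> w sw nw; have [E h1] := solution_hs_int sw nw.
rewrite /scalar_energy mu_s_min dU hU E.
move: (hs_int Om s w) h1 => A A1.
have c0 : 0 < 1 / 2 - 1 / p :> R by rewrite subr_gt0 !div1r ltf_pV2 ?posrE.
have := ler_wpM2l (ltW (mulr_gt0 c0 m0)) A1.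
rewrite -subr_ge0 => h; rewrite -subr_ge0; apply: le_trans h _.
by apply: le_of_eq; ring.
Qed.

End scalar_problem.

(** * Comparison of the system with the scalar problem *)

Section ground_states.
Context {R : realType} {N : nat}.
Variables (Om : set 'rV[R]_N) (s lambda mu kappa alpha beta : R).
Hypotheses (N3 : (3 <= N)%N) (oOm : open Om) (s0 : 0 < s) (s2 : s < 2).
Hypotheses (l0 : 0 < lambda) (mu0 : 0 < mu) (k0 : 0 < kappa).
Hypotheses (a1 : 1 < alpha) (b1 : 1 < beta) (abp : alpha + beta = hsexp N s).
Implicit Types (u v : fgrad R N) (x : 'rV[R]_N).

Local Notation p := (@hsexp R N s).
Local Notation sysint := (system_int Om s lambda mu kappa alpha beta).
Local Notation mixed := (mixed_int Om s alpha beta).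
Local Notation quotient := (system_quotient Om s lambda mu kappa alpha beta).
Local Notation g := (gfun N s lambda mu kappa beta).
Local Notation scalar_quotient u := (dirichlet Om u / hs_int Om s u `^ (2 / p)).

Let p_gt2 : 2 < p. Proof. exact: hsexp_gt2. Qed.
Let p_gt0 : 0 < p. Proof. exact: lt_trans p_gt2. Qed.
Let a0 : 0 < alpha. Proof. exact: lt_trans a1. Qed.
Let b0 : 0 < beta. Proof. exact: lt_trans b1. Qed.

Definition denom (t : R) : R := lambda + mu * t `^ p + p * kappa * t `^ beta.

Lemma denom_gt0 t : 0 < denom t.
Proof.
have h1 := mulr_ge0 (ltW mu0) (powR_ge0 t p).
have h2 := mulr_ge0 (mulr_ge0 (ltW p_gt0) (ltW k0)) (powR_ge0 t beta).
by rewrite /denom -addrA; apply: ltr_pwDl => //; exact: addr_ge0.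
Qed.

Lemma gfun_gt0 t : 0 < g t.
Proof. by rewrite divr_gt0 ?powR_gt0 ?denom_gt0// ltr_pwDl// sqr_ge0. Qed.

Lemma mixed_diag u : mixed u u = hs_int Om s u.
Proof.
apply: eq_Rintegral => x _; rewrite -powRD ?abp//.
by rewrite (gt_eqF p_gt0).
Qed.

Lemma quotient_diag u (t : R) : 0 < t -> D012 Om u ->
  quotient u (t *: u) = g t * scalar_quotient u.
Proof.
move=> t0 Du; have Dtu := D012Z N3 oOm t Du.
have mE : mixed u (t *: u) = t `^ beta * hs_int Om s u.
  have := mixed_intZ N3 oOm s0 s2 a1 b1 abp 1 t Du Du.
  by rewrite scale1r normr1 powR1 mul1r (gtr0_norm t0) mixed_diag.
have sE : sysint u (t *: u) = denom t * hs_int Om s u.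
  rewrite (system_intE N3 oOm s0 s2 lambda mu kappa a1 b1 abp Du Dtu).
  rewrite mE (hs_intZ N3 oOm s0 s2 t Du) (gtr0_norm t0) /denom.
  move: (hs_int Om s u) => A; ring.
rewrite /system_quotient sE (dirichletZ N3 oOm t Du).
rewrite powRM; [|exact/ltW/denom_gt0|exact: hs_int_ge0].
rewrite /gfun -/(denom t).
move: (dirichlet Om u) (hs_int Om s u `^ _) => d A.
rewrite invfM; ring.
Qed.

Variables (phi psi : fgrad R N).
Hypotheses (gs : system_ground_state Om s lambda mu kappa alpha beta phi psi)
  (phi0 : positive_on Om phi) (psi0 : positive_on Om psi).

Let Dphi : D012 Om phi. Proof. by case: gs => -[Du Dv _] _ _; exact: Du. Qed.
Let Dpsi : D012 Om psi. Proof. by case: gs => -[Du Dv _] _ _; exact: Dv. Qed.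

(** If one component vanished, [Om] would be null and so would the other. *)
Lemma ground_state_nonnull : ~ null_on Om phi /\ ~ null_on Om psi.
Proof.
have h u : positive_on Om u -> null_on Om u -> forall v, null_on Om v.
  move=> u0 nu v; apply: filterS2 nu u0 => x h1 h2 Omx.
  by have := h2 Omx; rewrite (h1 Omx) ltxx.
by case: gs => _ nn _; split=> n; apply: nn; split; exact: h n _.
Qed.

Let phi_nonnull : ~ null_on Om phi. Proof. exact: ground_state_nonnull.1. Qed.
Let psi_nonnull : ~ null_on Om psi. Proof. exact: ground_state_nonnull.2. Qed.

(** The norms [a], [b] and the scalar quotients [m1], [m2] of the components are
    kept as variables, which turns what follows into algebra in these numbers. *)
Variables (a b t0 m1 m2 : R).
Hypotheses (a_gt0 : 0 < a) (t_gt0 : 0 < t0) (bE : b = t0 * a)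
  (hphi : hs_int Om s phi = a `^ p) (hpsi : hs_int Om s psi = b `^ p)
  (dphi : dirichlet Om phi = m1 * a ^+ 2) (dpsi : dirichlet Om psi = m2 * b ^+ 2).

Let b_gt0 : 0 < b. Proof. by rewrite bE mulr_gt0. Qed.

Let powR_root (x : R) : 0 < x -> (x `^ p) `^ (2 / p) = x ^+ 2.
Proof.
move=> x0; rewrite -powRrM mulrC (divfK (lt0r_neq0 p_gt0)).
exact: (powR_mulrn 2 (ltW x0)).
Qed.

Let scalar_quotient_phi : scalar_quotient phi = m1.
Proof. by rewrite hphi dphi (powR_root a_gt0) (mulfK (lt0r_neq0 (exprn_gt0 2 a_gt0))). Qed.

Let scalar_quotient_psi : scalar_quotient psi = m2.
Proof. by rewrite hpsi dpsi (powR_root b_gt0) (mulfK (lt0r_neq0 (exprn_gt0 2 b_gt0))). Qed.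

Let m1_gt0 : 0 < m1.
Proof.
have := dirichlet_gt0 N3 oOm Dphi phi_nonnull.
by rewrite dphi (pmulr_lgt0 _ (exprn_gt0 2 a_gt0)).
Qed.

Let holder := mixed_holder N3 oOm s0 s2 a0 b0 abp Dphi Dpsi a_gt0 b_gt0 hphi hpsi.

Let bound_sysint : lambda * a `^ p + mu * b `^ p +
  p * kappa * (a `^ alpha * b `^ beta) = a `^ p * denom t0.
Proof.
have h r : b `^ r = t0 `^ r * a `^ r by rewrite bE (powRM _ (ltW t_gt0) (ltW a_gt0)).
have -> : a `^ alpha * b `^ beta = t0 `^ beta * a `^ p.
  by rewrite h -abp powRD ?(gt_eqF a_gt0) ?implybT// mulrCA.
by rewrite h /denom; ring.
Qed.

Let sysint_phi_psi : sysint phi psi =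
  lambda * a `^ p + mu * b `^ p + p * kappa * mixed phi psi.
Proof.
by rewrite (system_intE N3 oOm s0 s2 lambda mu kappa a1 b1 abp Dphi Dpsi) hphi hpsi.
Qed.

Let sysint_le : sysint phi psi <= a `^ p * denom t0.
Proof.
rewrite sysint_phi_psi -bound_sysint lerD2l.
exact: (ler_wpM2l (ltW (mulr_gt0 p_gt0 k0)) holder.1).
Qed.

Let sysint_gt0 : 0 < sysint phi psi.
Proof.
exact: (system_int_gt0 N3 oOm s0 s2 l0 mu0 k0 a1 b1 abp (ground_state_pair gs)).
Qed.

Let bound_pow : (a `^ p * denom t0) `^ (2 / p) = a ^+ 2 * denom t0 `^ (2 / p).
Proof.
by rewrite (powRM _ (powR_ge0 _ _) (ltW (denom_gt0 _))) (powR_root a_gt0).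
Qed.

Let lowerE : (m1 + m2 * t0 ^+ 2) / denom t0 `^ (2 / p) =
  (dirichlet Om phi + dirichlet Om psi) / (a `^ p * denom t0) `^ (2 / p).
Proof.
have d0 : 0 < denom t0 `^ (2 / p) by rewrite powR_gt0// denom_gt0.
rewrite bound_pow dphi dpsi bE; move: (denom t0 `^ _) d0 => d d0.
by field; rewrite !gt_eqF.
Qed.

Let bound_gt0 : 0 < a `^ p * denom t0.
Proof. exact: (mulr_gt0 (powR_gt0 _ a_gt0) (denom_gt0 _)). Qed.

Let p2_gt0 : 0 < 2 / p. Proof. exact: divr_gt0. Qed.

Let lower : (m1 + m2 * t0 ^+ 2) / denom t0 `^ (2 / p) <= quotient phi psi.
Proof.
rewrite lowerE /system_quotient; apply: ler_wpM2l.
  exact: (addr_ge0 (dirichlet_ge0 Om phi) (dirichlet_ge0 Om psi)).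
rewrite lef_pV2 ?posrE; [|exact: (powR_gt0 _ bound_gt0)|exact: (powR_gt0 _ sysint_gt0)].
by apply: (ge0_ler_powR (ltW p2_gt0) _ _ sysint_le); rewrite nnegrE;
  [exact: (ltW sysint_gt0)|exact: (ltW bound_gt0)].
Qed.

Let upper u (t : R) : D012 Om u -> ~ null_on Om u -> 0 < t ->
  quotient phi psi <= g t * scalar_quotient u.
Proof.
move=> Du nu tp; rewrite -(quotient_diag tp Du).
apply: (ground_state_quotient_min N3 oOm s0 s2 l0 mu0 k0 a1 b1 abp gs).
by split; [exact: Du|exact: (D012Z N3 oOm t Du)|case=> nu' _; exact: (nu nu')].
Qed.

(** Comparing with [(phi, t0 phi)] and with [(psi, t0 psi)] bounds a weighted mean of
    [m1] and [m2] by each of them. *)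
Let m12 : m1 = m2.
Proof.
have d0 : 0 < denom t0 `^ (2 / p) by rewrite powR_gt0// denom_gt0.
have h1 := le_trans lower (upper Dphi phi_nonnull t_gt0).
have h2 := le_trans lower (upper Dpsi psi_nonnull t_gt0).
move: h1 h2; rewrite scalar_quotient_phi scalar_quotient_psi /gfun -/(denom t0).
rewrite mulrAC [X in _ -> _ <= X -> _]mulrAC.
rewrite !(ler_pM2r (_ : 0 < (denom t0 `^ (2 / p))^-1)) ?invr_gt0//.
have tp : 0 < t0 ^+ 2 by exact: exprn_gt0.
move=> h1 h2; apply/eqP; rewrite eq_le; apply/andP; split.
  by rewrite -subr_ge0; move: h2; nra.
have : m2 * t0 ^+ 2 <= m1 * t0 ^+ 2 by move: h1; nra.
by rewrite ler_pM2r.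
Qed.

Let lower_g : g t0 * m1 <= quotient phi psi.
Proof.
apply: le_trans lower; rewrite -m12 /gfun -/(denom t0).
by move: (denom t0 `^ _) => d; apply: le_of_eq; ring.
Qed.

Let m1_min u : D012 Om u -> ~ null_on Om u -> m1 <= scalar_quotient u.
Proof.
move=> Du nu; rewrite -(ler_pM2l (gfun_gt0 t0)).
exact: le_trans lower_g (upper Du nu t_gt0).
Qed.

Let g_min t : 0 < t -> g t0 <= g t.
Proof.
move=> tp; have := upper Dphi phi_nonnull tp; rewrite scalar_quotient_phi => le.
by rewrite -(ler_pM2r m1_gt0); exact: le_trans lower_g le.
Qed.

(** A strict inequality would make [Q(phi, psi)] larger than [Q(phi, t0 phi)]. *)
Let sysint_eq : sysint phi psi = a `^ p * denom t0.
Proof.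
apply/eqP; rewrite eq_le sysint_le/= leNgt; apply/negP => lt.
have := upper Dphi phi_nonnull t_gt0; rewrite scalar_quotient_phi.
have -> : g t0 * m1 = (m1 + m2 * t0 ^+ 2) / denom t0 `^ (2 / p).
  rewrite -m12 /gfun -/(denom t0); move: (denom t0 `^ _) => d; ring.
rewrite lowerE /system_quotient; apply/negP; rewrite -ltNge.
have E0 : 0 < dirichlet Om phi + dirichlet Om psi.
  exact: (dirichlet_pair_gt0 N3 oOm (ground_state_pair gs)).
rewrite (ltr_pM2l E0) ltf_pV2 ?posrE;
  [|exact: (powR_gt0 _ bound_gt0)|exact: (powR_gt0 _ sysint_gt0)].
by apply: (gt0_ltr_powR p2_gt0 _ _ lt); rewrite nnegrE;
  [exact: (ltW sysint_gt0)|exact: (ltW bound_gt0)].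
Qed.

Let components_proportional :
  {ae leb N, forall x, Om x -> b * phi.1 x = a * psi.1 x}.
Proof.
have mE : mixed phi psi = a `^ alpha * b `^ beta.
  have := sysint_eq; rewrite sysint_phi_psi -bound_sysint => /addrI.
  exact: (mulfI (lt0r_neq0 (mulr_gt0 p_gt0 k0))).
apply: filterS3 phi0 psi0 (holder.2 mE) => x h1 h2 h3 Omx.
have p1 := h1 Omx; have p2 := h2 Omx.
by have := h3 Omx; rewrite !gtr0_norm//; apply.
Qed.

Let S_constE' : S_const Om s lambda mu kappa alpha beta = (a `^ p * denom t0) `^ ((p - 2) / p).
Proof.
rewrite (S_constE N3 oOm s0 s2 l0 mu0 k0 a1 b1 abp gs) /system_quotient.
rewrite (ground_state_nehari N3 oOm s0 s2 a1 b1 abp gs) sysint_eq.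
rewrite -{1}[a `^ p * denom t0]powRr1 ?(ltW bound_gt0)// -powRN -powRD; last first.
  by rewrite (gt_eqF bound_gt0) implybT.
by congr (_ `^ _); field; rewrite gt_eqF.
Qed.

(** On the Nehari set [S = B / B^(2/p) = B^((p-2)/p)], and [B = a^p denom(t0)], so that
    [S^(1/(p-2)) = a denom(t0)^(1/p)]. *)
Let CconstE : Cconst Om s lambda mu kappa alpha beta t0 = a.
Proof.
rewrite /Cconst -/(denom t0) S_constE' -powRrM.
rewrite (_ : (p - 2) / p * (1 / (p - 2)) = p^-1); last first.
  by field; rewrite !gt_eqF// subr_gt0.
rewrite powRM ?powR_ge0 ?(ltW (denom_gt0 _))// -powRrM mulfV ?gt_eqF//.
rewrite powRr1 ?(ltW a_gt0)// -mulrA -powRD; last first.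
  by rewrite (gt_eqF (denom_gt0 _)) implybT.
by rewrite div1r subrr powRr0 mulr1.
Qed.

Lemma normalised_ground_state :
  let C := Cconst Om s lambda mu kappa alpha beta t0 in let U := C^-1 *: phi in
  [/\ scalar_ground_state Om s U,
      g t0 = inf [set g t | t in [set t : R | 0 < t]],
      {ae leb N, forall x, Om x -> phi.1 x = C * U.1 x}
    & {ae leb N, forall x, Om x -> psi.1 x = t0 * C * U.1 x}].
Proof.
move=> C U; rewrite {}/U (CconstE : C = a) {C}; have an0 := lt0r_neq0 a_gt0.
have ai0 : 0 < a^-1 by rewrite invr_gt0.
split.
- apply: (@scalar_ground_state_min _ _ _ _ N3 oOm s0 s2 _ m1).
  + exact: (D012Z N3 oOm a^-1 Dphi).
  + apply: filterS phi0 => x h Omx; exact: (mulr_gt0 ai0 (h Omx)).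
  + rewrite (hs_intZ N3 oOm s0 s2 _ Dphi) (gtr0_norm ai0) hphi.
    by rewrite -(powRM _ (ltW ai0) (ltW a_gt0)) (mulVf an0) powR1.
  + by rewrite (dirichletZ N3 oOm _ Dphi) dphi; field; exact: an0.
  + exact: m1_gt0.
  + move=> u Du nu; have A0 := hs_int_gt0 N3 oOm s0 s2 Du nu.
    by have := m1_min Du nu; rewrite (ler_pdivlMr _ _ (powR_gt0 _ A0)).
- apply/esym/inf_eq_min; first by exists t0.
  by move=> _ [t tp <-]; exact: g_min.
- apply: nearW => x _; rewrite -[(a^-1 *: phi).1 x]/(a^-1 * phi.1 x).
  by rewrite (mulVKf an0).
- apply: filterS components_proportional => x h Omx.
  rewrite -[(a^-1 *: phi).1 x]/(a^-1 * phi.1 x) -bE.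
  by rewrite [RHS]mulrCA (h Omx) (mulKf an0).
Qed.

End ground_states.

Theorem theorem4 (R : realType) (N : nat) (Omega : set 'rV[R]_N)
    (s lambda mu kappa alpha beta : R) (phi psi : fgrad R N) :
  (3 <= N)%N ->
  cone Omega \/ (domain Omega /\ ~ closure Omega 0) ->
  0 < s -> s < 2 ->
  0 < lambda -> 0 < mu -> 0 < kappa ->
  1 < alpha -> 1 < beta -> alpha + beta = hsexp N s ->
  system_ground_state Omega s lambda mu kappa alpha beta phi psi ->
  positive_on Omega phi -> positive_on Omega psi ->
  exists (U : fgrad R N) (t0 : R),
    let C := Cconst Omega s lambda mu kappa alpha beta t0 in
    [/\ scalar_ground_state Omega s U,
        0 < t0,
        gfun N s lambda mu kappa beta t0 =
          inf [set gfun N s lambda mu kappa beta t | t in [set t : R | 0 < t]],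
        {ae leb N, forall x, Omega x -> phi.1 x = C * U.1 x}
      & {ae leb N, forall x, Omega x -> psi.1 x = t0 * C * U.1 x}].
Proof.
move=> N3 hOm s0 s2 l0 mu0 k0 a1 b1 abp gs phi0 psi0.
have oOm : open Omega by case: hOm => [[[]]|[[]]].
have [phin psin] := ground_state_nonnull gs phi0 psi0.
have [[Dphi Dpsi _] _ _] := gs.
have p0 : 0 < hsexp N s := lt_trans (ltr0n _ 2) (hsexp_gt2 N3 s2).
pose root u := hs_int Omega s u `^ (hsexp N s)^-1.
have root_gt0 u : 0 < hs_int Omega s u -> 0 < root u by move=> A0; exact: powR_gt0.
have rootP u : 0 < hs_int Omega s u -> hs_int Omega s u = root u `^ hsexp N s.
  by move=> A0; rewrite /root -powRrM (mulVf (lt0r_neq0 p0)) (powRr1 (ltW A0)).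
have A0 := hs_int_gt0 N3 oOm s0 s2 Dphi phin.
have B0 := hs_int_gt0 N3 oOm s0 s2 Dpsi psin.
have a0 := root_gt0 _ A0; have b0 := root_gt0 _ B0.
have dE u : 0 < root u -> dirichlet Omega u = dirichlet Omega u / root u ^+ 2 * root u ^+ 2.
  by move=> r0; rewrite (divfK (lt0r_neq0 (exprn_gt0 2 r0))).
have t_gt0 := divr_gt0 b0 a0.
have tE : root psi = root psi / root phi * root phi by rewrite (divfK (lt0r_neq0 a0)).
have [gU gt hphi hpsi] := normalised_ground_state N3 oOm s0 s2 l0 mu0 k0 a1 b1 abp gs
  phi0 psi0 a0 t_gt0 tE (rootP _ A0) (rootP _ B0) (dE _ a0) (dE _ b0).
eexists; exists (root psi / root phi).
by split; [exact: gU|exact: t_gt0|exact: gt|exact: hphi|exact: hpsi].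
Qed.
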